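(* Let $\mathbf{G}=\mathbf{G}_n=GSpin_{2n}$ or $GSpin_{2n+1}$, let $\mathbf{M}\simeq GL_{n_1}\times\cdots\times GL_{n_r}\times\mathbf{G}_m$ be a proper standard Levi subgroup of $\mathbf{G}$, and let $\sigma\simeq\sigma_1\otimes\cdots\otimes\sigma_r\otimes\tau$ be an irreducible discrete series representation of $M$ on a space $V$. For each $w\in R(\sigma)$ choose an intertwining operator $T_w:V\to V$ such that $T_w\circ w\sigma=\sigma\circ T_w$. Then the operators $T_w$ can be chosen so that $T_{w_1w_2}=T_{w_1}T_{w_2}$ for all $w_1,w_2\in R(\sigma)$.
   Context: $F$ is a nonarchimedean local field of characteristic zero; $G=\mathbf{G}(F)$. $\mathbf{G}_m$ is the split general spin group of the same type ($B$ or $D$) as $\mathbf{G}$ of semisimple rank $m$, with $\mathbf{G}_0=GL_1$. $\mathrm{Ind}$ is normalized parabolic induction. $\mathbf{P}=\mathbf{M}\mathbf{N}$ is the standard parabolic subgroup with Levi $\mathbf{M}$, $\mathbf{A}$ is the split component of $\mathbf{M}$, $\Phi(\mathbf{P},\mathbf{A})$ is the set of reduced roots of $\mathbf{A}$ in $\mathbf{P}$ (the positive roots), and $W(\mathbf{G},\mathbf{A})=N_{\mathbf{G}}(\mathbf{A})/\mathbf{M}\subset S_r\ltimes(\mathbb{Z}/2)^r$. The block sign change $C_i$ acts on $M$ by $C_i\cdot(g_1,\dots,g_i,\dots,g_r,h)=(g_1,\dots,{}^tg_i^{-1},\dots,g_r,e_0^*(\det g_i)h)$, where $e_0^*:GL_1\to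 Z(\mathbf{G}_m)^\circ$ is the standard cocharacter. In type $D_n$ with $m>0$ and $n_i$ odd the $i$-th sign change in $W(\mathbf{G},\mathbf{A})$ is $C_ic_n$, acting by $(g_1,\dots,g_r,h)\mapsto(g_1,\dots,{}^tg_i^{-1},\dots,g_r,e_0^*(\det g_i)(c_n\cdot h))$, with $c_n$ the outer automorphism of $\mathbf{G}_m$ coming from its Dynkin diagram; in type $D_n$ with $m=0$ only products with an even number of $C_i$ with $n_i$ odd occur. For $w\in R(\sigma)$ (which is a group of such sign changes), $w\sigma$ is the representation of $M$ on $V$ obtained from $\sigma$ by composing with this action of $w$ on $M$. Let $W(\sigma)=\{w\in W(\mathbf{G},\mathbf{A})\mid w\sigma\simeq\sigma\}$. For $\alpha\in\Phi(\mathbf{P},\mathbf{A})$ let $\mathbf{A}_\alpha=(\mathbf{A}\cap\ker\alpha)^\circ$, $\mathbf{M}_\alpha=Z_{\mathbf{G}}(\mathbf{A}_\alpha)$, ${}^*\mathbf{P}_\alpha=\mathbf{P}\cap\mathbf{M}_\alpha$, $W_\alpha=W(\mathbf{M}_\alpha,\mathbf{A})$, with nontrivial element $w_\alpha$ if $W_\alpha\ne\{1\}$. The Plancherel measure $\mu_\alpha(\sigma)$ vanishes iff $W_\alpha\neq\{1\}$, $w_\alpha\sigma\simeq\sigma$ and $\mathrm{Ind}_{{}^*P_\alpha}^{M_\alpha}(\sigma)$ is irreducible. Put $\Delta'=\{\alpha\mid\mu_\alpha(\sigma)=0\}$. The Knapp–Stein $R$-group is $R(\sigma)=\{w\in W(\sigma)\mid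 w\alpha>0\text{ for all }\alpha\in\Delta'\}$. *)

(* Defs.v *)
From HB Require Import structures.
From mathcomp Require Import all_boot all_order all_algebra all_fingroup all_field.
From mathcomp Require Import complex.
From mathcomp Require Import all_classical all_reals all_analysis.

Set Implicit Arguments.
Unset Strict Implicit.
Unset Printing Implicit Defensive.

Import Order.TTheory GRing.Theory Num.Theory.

Local Open Scope classical_set_scope.
Local Open Scope ring_scope.

Section LocalField.
Variables (F : fieldType) (ord : F -> int).

Definition ord_ge (N : int) (x : F) : Prop := x = 0 \/ N <= ord x.

(* [ord] is a normalized discrete valuation (its value at 0 is irrelevant) for
   which F is complete, with a residue field of q elements. *)
Record nonarch_local_field (q : nat) : Prop := NonarchLocalField {
  ordM : forall x y : F, x != 0 -> y != 0 -> ord (x * y) = ord x + ord y;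
  ordD : forall N x y, ord_ge N x -> ord_ge N y -> ord_ge N (x + y);
  ord_unif : exists2 x : F, x != 0 & ord x = 1;
  ord_complete : forall u : nat -> F,
    (forall N, exists k, forall i j, (k <= i)%N -> (k <= j)%N ->
       ord_ge N (u i - u j)) ->
    exists l, forall N, exists k, forall i, (k <= i)%N -> ord_ge N (u i - l);
  ord_residue : exists s : seq F,
    [/\ uniq s, size s = q, forall c, c \in s -> ord_ge 0 c &
     forall x, ord_ge 0 x -> exists! c, c \in s /\ ord_ge 1 (x - c)]
}.

End LocalField.

(* A topological group, presented as a subset of a type carrying a
   multiplication; the sets {y | lcong N x y}, N in nat, are a basis of
   neighbourhoods of x. *)
Record lgroup := LGroup {
  lsort :> Type;
  lmem : set lsort;
  lmul : lsort -> lsort -> lsort;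
  lone : lsort;
  lcong : nat -> lsort -> lsort -> Prop
}.
Arguments lmem : clear implicits.
Arguments lone : clear implicits.

HB.instance Definition _ (G : lgroup) := gen_eqMixin (lsort G).
HB.instance Definition _ (G : lgroup) := gen_choiceMixin (lsort G).
HB.instance Definition _ (G : lgroup) := isPointed.Build (lsort G) (lone G).

Section Representations.
Variables (R : realType) (G : lgroup).
Implicit Types V W : lmodType R[i].

Definition is_rep V (rho : G -> V -> V) : Prop :=
  [/\ forall g, lmem G g -> linear (rho g),
      forall v, rho (lone G) v = v &
      forall g h v, lmem G g -> lmem G h ->
        rho (lmul g h) v = rho g (rho h v)].

Definition smooth_rep V (rho : G -> V -> V) : Prop :=
  forall v, exists N, forall k, lmem G k -> lcong N k (lone G) -> rho k v = v.

Definition rep_iso V W (rho : G -> V -> V) (rho' : G -> W -> W) : Prop :=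
  exists T : {linear V -> W}, bijective T /\
    forall g v, lmem G g -> T (rho g v) = rho' g (T v).

Definition smooth_functional V (rho : G -> V -> V) (f : V -> R[i]) : Prop :=
  exists N, forall k v, lmem G k -> lcong N k (lone G) -> f (rho k v) = f v.

Definition lcenter : set G :=
  [set z | lmem G z /\ forall g, lmem G g -> lmul z g = lmul g z].

(* The inverse images in G of the open subsets of G / lcenter; the sets of the
   sigma-algebra they generate which are contained in G are the inverse images
   of the Borel subsets of G / lcenter. *)
Definition open_mod_center : set (set G) :=
  [set U | [/\ U `<=` lmem G,
    forall x, U x -> exists N, forall y, lmem G y -> lcong N x y -> U y &
    forall x z, U x -> lcenter z -> U (lmul x z)]].

Definition quotient_space := g_sigma_algebraType open_mod_center.

Definition haar_mod_center (mu : {measure set quotient_space -> \bar R}) : Prop :=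
  [/\ forall (g : G) (A : set quotient_space), lmem G g -> measurable A ->
        A `<=` lmem G -> mu ((lmul g : G -> G) @` A) = mu A,
      exists N, (mu [set x | exists k z, [/\ lmem G k, lcong N k (lone G),
                            lcenter z & x = lmul k z]] < +oo)%E &
      (0 < mu (lmem G))%E].

Definition square_integrable_mod_center V (rho : G -> V -> V) : Prop :=
  exists2 mu : {measure set quotient_space -> \bar R}, haar_mod_center mu &
    forall (v : V) (f : {linear V -> R[i]^o}), smooth_functional rho f ->
      (\int[mu]_(g in lmem G) ((Normc.normc (f (rho g v))) ^+ 2)%:E < +oo)%E.

Definition unitary_central_character V (rho : G -> V -> V) : Prop :=
  forall z, lcenter z -> exists w : R[i], `|w| = 1 /\ forall v, rho z v = w *: v.

End Representations.

(* Algebraic irreducibility of the operators [rho g], g in S, on the subspace E. *)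
Definition irreducible_on (K : fieldType) (T : Type) (W : lmodType K)
    (S : set T) (rho : T -> W -> W) (E : set W) : Prop :=
  (exists2 w, E w & w != 0) /\
  forall U : set W, U `<=` E -> U 0 ->
    (forall a u v, U u -> U v -> U (a *: u + v)) ->
    (forall g u, S g -> U u -> U (rho g u)) ->
    U = [set 0] \/ U = E.

Definition irreducible_discrete_series (R : realType) (G : lgroup)
    (V : lmodType R[i]) (rho : G -> V -> V) : Prop :=
  [/\ is_rep rho, smooth_rep rho, irreducible_on (lmem G) rho setT,
      unitary_central_character rho & square_integrable_mod_center rho].

Section Tensor.
Variables (K : fieldType) (I : finType) (Vs : I -> lmodType K) (Vt : lmodType K).

Definition multilinear (U : lmodType K) (b : (forall i, Vs i) -> Vt -> U) : Prop :=
  (forall i (x : forall i, Vs i) (y : Vt) (c : K) (u v : Vs i),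
     b (eqtype.dfwith x (c *: u + v)) y = c *: b (eqtype.dfwith x u) y + b (eqtype.dfwith x v) y) /\
  (forall x, linear (b x)).

(* [t] exhibits V as the tensor product of the Vs i and of Vt. *)
Definition is_tensor (V : lmodType K) (t : (forall i, Vs i) -> Vt -> V) : Prop :=
  multilinear t /\
  forall (U : lmodType K) (b : (forall i, Vs i) -> Vt -> U), multilinear b ->
    exists f : {linear V -> U}, (forall x y, f (t x y) = b x y) /\
      forall f' : {linear V -> U}, (forall x y, f' (t x y) = b x y) -> f' =1 f.

End Tensor.

(* Elements of S_r |x (Z/2)^r: [w] sends e_i to e_(w.1 i) if [w.2 i] is false,
   and to - e_(w.1 i) if [w.2 i] is true; [smul w w'] is w after w'. *)
Definition sperm (r : nat) : Type := ({perm 'I_r} * {ffun 'I_r -> bool})%type.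

Definition smul r (w w' : sperm r) : sperm r :=
  ((w'.1 * w.1)%g, [ffun i => w'.2 i (+) w.2 (w'.1 i)]).

Definition sone r : sperm r := (1%g, [ffun=> false]).

(* Action on r-tuples of integers (characters) and on r-tuples of units. *)
Definition schar r (w : sperm r) (a : {ffun 'I_r -> int}) : {ffun 'I_r -> int} :=
  [ffun j => let i := (w.1^-1)%g j in if w.2 i then - a i else a i].

Definition storus (F : fieldType) r (w : sperm r) (t : 'I_r -> F) : 'I_r -> F :=
  fun j => let i := (w.1^-1)%g j in if w.2 i then (t i)^-1 else t i.

Definition char_eval (F : fieldType) r (a : {ffun 'I_r -> int}) (t : 'I_r -> F) : F :=
  \prod_i t i ^ a i.

(* The split quadratic space of dimension 2n + isB, n = \sum_i ns i + m, with
   basis e_k = inl (k, false), f_k = inl (k, true) (k in [half_index]) and, if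
   isB, one further vector u = inr ord0; the e_k and the f_k are isotropic,
   e_k and f_k are dual (e_k f_k + f_k e_k = 1 in the Clifford algebra), Q u = 1,
   and all other pairs are orthogonal. *)
Definition half_index (r : nat) (ns : 'I_r -> nat) (m : nat) : finType :=
  ({i : 'I_r & 'I_(ns i)} + 'I_m)%type.

Definition basis_index (isB : bool) r (ns : 'I_r -> nat) m : finType :=
  ((half_index ns m * bool) + 'I_isB)%type.

Definition qspace (F : fieldType) isB r (ns : 'I_r -> nat) m : lmodType F :=
  {ffun basis_index isB ns m -> F^o}.

Definition split_form (F : fieldType) isB r (ns : 'I_r -> nat) m
    (v : qspace F isB ns m) : F :=
  (\sum_(k : half_index ns m) (v (inl (k, false)) : F) * (v (inl (k, true)) : F)) +
  \sum_(j : 'I_isB) (v (inr j) : F) ^+ 2.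

Section GSpin.
Variables (F : fieldType) (ord : F -> int) (q : nat).
Variables (isB : bool) (r : nat) (ns : 'I_r -> nat) (m : nat).
Variables (Cl : falgType F) (cl : {linear qspace F isB ns m -> Cl}).

Definition is_clifford : Prop :=
  (forall v, cl v * cl v = split_form v *: 1) /\
  forall (B : algType F) (f : {linear qspace F isB ns m -> B}),
    (forall v, f v * f v = split_form v *: 1) ->
    exists g : {lrmorphism Cl -> B}, (forall v, g (cl v) = f v) /\
      forall g' : {lrmorphism Cl -> B}, (forall v, g' (cl v) = f v) -> g' =1 g.

Definition gen (b : basis_index isB ns m) : Cl :=
  cl [ffun b' => ((b' == b)%:R : F^o)].

Definition gen_e i (a : 'I_(ns i)) : Cl :=
  gen (inl (inl (Tagged (fun i => 'I_(ns i)) a), false)).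

(* The position of a basis vector in the flag
   W_1 < W_1 + W_2 < ... < W < W^perp < ... stabilized by P. *)
Definition level (b : basis_index isB ns m) : nat :=
  match b with
  | inl (inl k, false) => tag k
  | inl (inl k, true) => r.*2 - tag k
  | _ => r
  end.

Definition Vfull : {vspace Cl} := (\sum_b <[gen b]>)%VS.
Definition Vcore : {vspace Cl} := (\sum_(b | level b == r) <[gen b]>)%VS.
Definition Vbelow (l : nat) : {vspace Cl} := (\sum_(b | (level b < l)%N) <[gen b]>)%VS.

(* The group of F-points of the general spin group of the quadratic space
   U: the even (special) Clifford group.  It is GL_1 if dim U <= 1. *)
Definition gspin (U : {vspace Cl}) : set Cl :=
  [set x | [/\ x \in agenv (U * U)%VS, x \is a GRing.unit &
           forall y, y \in U -> x * y * x^-1 \in U]].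

Definition Gn : set Cl := gspin Vfull.
Definition Gm : set Cl := gspin Vcore.

Definition cl_cong (N : nat) (x y : Cl) : Prop :=
  forall k, ord_ge ord N (coord (vbasis {:Cl}%VS) k (x - y)).

Definition mx_cong (k : nat) (N : nat) (x y : 'M[F]_k) : Prop :=
  forall a b, ord_ge ord N (x a b - y a b).

Definition GL_group (k : nat) : lgroup :=
  @LGroup 'M[F]_k [set g | g \in unitmx] mulmx 1%:M (@mx_cong k).

Definition Gm_group : lgroup := @LGroup Cl Gm *%R 1 cl_cong.

Definition levi_group : lgroup :=
  @LGroup ((forall i, 'M[F]_(ns i)) * Cl)%type
    [set g | (forall i, g.1 i \in unitmx) /\ Gm g.2]
    (fun g h => (fun i => g.1 i *m h.1 i, g.2 * h.2))
    (fun i => 1%:M, 1)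
    (fun N g h => (forall i, mx_cong N (g.1 i) (h.1 i)) /\ cl_cong N g.2 h.2).

(* The product of the f_k, k running over the r general linear blocks. *)
Definition vacuum : Cl :=
  \prod_(k : {i : 'I_r & 'I_(ns i)}) gen (inl (inl k, true)).

(* The element of G_n corresponding to (g_1, ..., g_r, h); here GL_(n_i) acts
   on W_i in the standard way, and its lift to G_n is the one fixing the vacuum
   vector of the spin representation Cl * vacuum: for n_i = 1, t in GL_1 maps to
   t e f + f e.  These conditions determine the element; the action on the span
   of the f_k is then the contragredient one. *)
Definition levi_embed (g : levi_group) : Cl :=
  xget 0 [set x | [/\ Gn x,
    forall i (a : 'I_(ns i)),
      x * gen_e a * x^-1 = \sum_(b : 'I_(ns i)) g.1 i b a *: gen_e b,
    forall y, y \in Vcore -> x * y * x^-1 = g.2 * y * g.2^-1 &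
    x * vacuum = g.2 * vacuum]].

Definition levi : set Cl := levi_embed @` lmem levi_group.

(* The unipotent radical N of the standard parabolic subgroup P = MN, and its
   Lie algebra inside Lie G_n = span {x y | x, y in V}. *)
Definition unip_rad : set Cl :=
  [set x | [/\ Gn x, exists k, (x - 1) ^+ k = 0 &
    forall b, x * gen b * x^-1 - gen b \in Vbelow (level b)]].

Definition lie_pair (bb : basis_index isB ns m * basis_index isB ns m) : Cl :=
  gen bb.1 * gen bb.2.

Definition lie_unip : {vspace Cl} :=
  (\sum_(bb | (level bb.1 + level bb.2 < r.*2)%N) <[lie_pair bb]>)%VS.

Definition nonzero_tuple (t : 'I_r -> F) : Prop := forall i, t i != 0.

Definition torus_elt (t : 'I_r -> F) (z : F) : Cl :=
  levi_embed ((fun i => (t i)%:M, z *: 1) : levi_group).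

(* All nonzero weights of A in Lie N, then the reduced ones. *)
Definition weight_in_P (a : {ffun 'I_r -> int}) : Prop :=
  a != 0 /\ exists X, [/\ X \in lie_unip, X != 0 &
    forall t, nonzero_tuple t ->
      torus_elt t 1 * X * (torus_elt t 1)^-1 = char_eval a t *: X].

Definition Phi : set {ffun 'I_r -> int} :=
  [set a | weight_in_P a /\
    forall (b : {ffun 'I_r -> int}) (k : nat), weight_in_P b -> a = b *+ k -> k = 1%N].

(* A_alpha: the identity component of A /\ ker alpha is the intersection of
   the kernels of the characters of which alpha is a positive multiple. *)
Definition A_alpha (a : {ffun 'I_r -> int}) : set Cl :=
  [set x | exists (t : 'I_r -> F) (z : F), [/\ nonzero_tuple t, z != 0, x = torus_elt t z &
    forall (b : {ffun 'I_r -> int}) (k : nat), (0 < k)%N -> b *+ k = a ->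
      char_eval b t = 1]].

Definition M_alpha (a : {ffun 'I_r -> int}) : set Cl :=
  [set x | Gn x /\ forall y, A_alpha a y -> x * y = y * x].

Definition lie_unip_alpha (a : {ffun 'I_r -> int}) : {vspace Cl} :=
  (\sum_(bb | (level bb.1 + level bb.2 < r.*2)%N &&
      `[< forall y, A_alpha a y -> (y * lie_pair bb = lie_pair bb * y)%R >])
     <[lie_pair bb]>)%VS.

(* W(H, A) = N_H(A) / M for M < H < G_n, as a subgroup of S_r |x (Z/2)^r through
   its (faithful) action on A modulo scalars. *)
Definition weyl (H : set Cl) : set (sperm r) :=
  [set w : sperm r | (forall i, ns (w.1 i) = ns i) /\
    exists2 x, H x & forall t, nonzero_tuple t ->
      exists2 z : F, z != 0 & x * torus_elt t 1 * x^-1 = torus_elt (storus w t) z].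

(* The outer automorphism c_m of G_m in type D, m > 0: conjugation by
   e_m - f_m, which interchanges the last two simple roots. *)
Definition outer (h : Cl) : Cl :=
  if [pick k : 'I_m | k.+1 == m] is Some k then
    let v := gen (inl (inr k, false)) - gen (inl (inr k, true)) in v * h * v^-1
  else h.

(* The action of W(G, A) on M.  The block permutations permute the g_i (the
   cast by conform_mx is along ns (w.1 i) = ns i); scalars are e_0^*. *)
Definition weyl_act (w : sperm r) (g : levi_group) : levi_group :=
  (fun j => let i := (w.1^-1)%g j in
     conform_mx (1%:M : 'M[F]_(ns j))
       (if w.2 i then (invmx (g.1 i))^T else g.1 i),
   (\prod_(i | w.2 i) \det (g.1 i)) *:
     (if ~~ isB && odd (\sum_(i | w.2 i) ns i) then outer g.2 else g.2)).

Definition sinv (w : sperm r) : sperm r :=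
  ((w.1^-1)%g, [ffun j => w.2 ((w.1^-1)%g j)]).

Section Rgroup.
Variables (R : realType) (V : lmodType R[i]) (sigma : levi_group -> V -> V).

Definition twist (w : sperm r) : levi_group -> V -> V :=
  fun g => sigma (weyl_act (sinv w) g).

Definition W_sigma : set (sperm r) :=
  [set w : sperm r | weyl Gn w /\ rep_iso (twist w) sigma].

(* The modulus character |det (Ad x | Lie *N_alpha)|. *)
Definition modulus (a : {ffun 'I_r -> int}) (x : Cl) : R :=
  let n := lie_unip_alpha a in
  (q%:R : R) ^ (- ord (\det (\matrix_(i, j < \dim n)
     coord (vbasis n) j (x * (vbasis n)`_i * x^-1)))).

(* The space of normalized induction from *P_alpha = M *N_alpha to M_alpha;
   functions on M_alpha are extended by zero to Cl. *)
Definition ind_space (a : {ffun 'I_r -> int}) : set (Cl -> V) :=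
  [set f | [/\ forall x, ~ M_alpha a x -> f x = 0,
    forall g n x, lmem levi_group g -> unip_rad n -> M_alpha a n -> M_alpha a x ->
      f (levi_embed g * n * x) =
      (Num.sqrt (modulus a (levi_embed g)))%:C%C *: sigma g (f x) &
    exists N, forall x k, M_alpha a x -> M_alpha a k -> cl_cong N k 1 ->
      f (x * k) = f x]].

Definition ind_irreducible (a : {ffun 'I_r -> int}) : Prop :=
  irreducible_on (M_alpha a) (fun g (f : Cl -> V) => fun x => f (x * g))
    (ind_space a).

(* mu_alpha(sigma) = 0, through its characterization; W(M_alpha, A) has at most
   one nontrivial element. *)
Definition plancherel_zero (a : {ffun 'I_r -> int}) : Prop :=
  exists w, [/\ weyl (M_alpha a) w, w <> sone r, rep_iso (twist w) sigma &
    ind_irreducible a].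

Definition Delta' : set {ffun 'I_r -> int} :=
  [set a | Phi a /\ plancherel_zero a].

Definition R_group : set (sperm r) :=
  [set w : sperm r | W_sigma w /\ forall a, Delta' a -> Phi (schar w a)].

End Rgroup.

End GSpin.

(* Main.v *)
Require Import Defs.
From HB Require Import structures.
From mathcomp Require Import all_boot all_order all_algebra all_fingroup all_field.
From mathcomp Require Import complex zify.
From mathcomp Require Import all_classical all_reals all_analysis.

Set Implicit Arguments.
Unset Strict Implicit.
Unset Printing Implicit Defensive.

Import Order.TTheory GRing.Theory Num.Theory.

Local Open Scope classical_set_scope.
Local Open Scope ring_scope.

(** The operators are constructed on the whole stabilizer of [sigma] among the
    signed block permutations, of which [R(sigma)] is a subset: the 2-cocycle
    of the stabilizer, with values in the multiplicative group of the complex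
    numbers, is a coboundary.

    A signed permutation [w] permutes the blocks of [M] and replaces some of the
    [g_i] by their contragredients, so [w sigma] is again an exterior tensor
    product.  If [w sigma] is isomorphic to [sigma], then each [sigma_j], dualized
    (and twisted by the central character of [tau] on scalars) when [w] changes
    the sign of [j], is isomorphic to [sigma_(w j)], and [tau] is isomorphic to
    its composite with the outer automorphism if [w] acts through it
    ([sigmas_iso_exists], [tau_iso_exists]).  So it is enough to choose
    isomorphisms [A_(i,j,e)] from [sigma_i], dualized or not according to the
    sign [e], to [sigma_j], in such a way that
    [A_(j,k,d) A_(i,j,e) = A_(i,k,e+d)], and similarly for [tau]: then [T_w]
    permutes the tensor factors by [w] and applies [A_(j,w j,e)] to the [j]-th
    one, and multiplicativity is read off on pure tensors.

    Such a choice exists ([coherent_isos]).  After fixing a representative of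
    each class of the [sigma_i] up to isomorphism and duality, and isomorphisms
    from it to the other members, only the self-dualities of the representatives
    remain; the square of a self-duality is a scalar by Schur's lemma, and can be
    normalized to 1.

    Two ingredients come from representation theory.  Schur's lemma for [sigma]
    is Dixmier's argument in countable dimension ([schur_countable_dim]); the
    dimension is countable because [sigma] is smooth and [M] is separable
    ([levi_countable_dim]).  The passage from [V] to its factors
    ([factor_simple], [factor_schur]) and the comparison of factors rest on the
    fact that [V], restricted to one factor of [M], is a sum of copies of the
    corresponding factor of [sigma], so that all its simple subrepresentations
    are isomorphic to that factor ([simple_sub_isotypic]). *)

(** * Linear maps and simple representations *)

Section LinearFunctions.
Variables (K : fieldType) (U V : lmodType K) (f : U -> V).
Hypothesis f_lin : linear f.

Definition linear_pack : {linear U -> V} :=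
  HB.pack f (GRing.isLinear.Build K U V *:%R f f_lin).

Lemma lin0 : f 0 = 0. Proof. exact: (linear0 linear_pack). Qed.
Lemma linB u v : f (u - v) = f u - f v. Proof. exact: (linearB linear_pack). Qed.
Lemma linZ a u : f (a *: u) = a *: f u. Proof. exact: (linearZZ linear_pack). Qed.
Lemma lin_sum (I : Type) (s : seq I) (F : I -> U) :
  f (\sum_(i <- s) F i) = \sum_(i <- s) f (F i).
Proof. exact: (linear_sum linear_pack). Qed.
Lemma lin_inj : (forall u, f u = 0 -> u = 0) -> injective f.
Proof. by move=> f0 u v e; apply/subr0_eq/f0; rewrite linB e subrr. Qed.
Lemma lin_can (g : V -> U) : cancel f g -> cancel g f -> linear g.
Proof. by move=> fK gK a u v; rewrite -[in LHS](gK u) -[in LHS](gK v) -f_lin fK. Qed.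

End LinearFunctions.

Lemma lin_comp (K : fieldType) (U V W : lmodType K) (f : V -> W) (g : U -> V) :
  linear f -> linear g -> linear (f \o g).
Proof. by move=> lf lg a u v /=; rewrite lg lf. Qed.

Lemma lin_scale (K : fieldType) (U V : lmodType K) (f : U -> V) (c : K) :
  linear f -> linear (fun u => c *: f u).
Proof. by move=> lf a u v; rewrite lf scalerDr !scalerA mulrC. Qed.

Lemma inj_surj_bij (A B : Type) (f : A -> B) :
  injective f -> (forall y, exists x, f x = y) -> bijective f.
Proof.
move=> fI /choice[g gP]; exists g => // x; exact/fI.
Qed.

Lemma scale_bijective (K : fieldType) (A : Type) (V : lmodType K) (f : A -> V) (c : K) :
  c != 0 -> bijective f -> bijective (fun x => c *: f x).
Proof.
move=> c0 [g fK gK]; exists (fun v => g (c^-1 *: v)) => v; first by rewrite scalerK.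
by rewrite gK scalerKV.
Qed.

Section Simple.
Variables (K : fieldType) (T : Type) (S : set T) (V : lmodType K).
Variable rho : T -> V -> V.
Hypothesis rho_simple : irreducible_on S rho setT.

Lemma simple_eq0 (U : set V) : U 0 ->
    (forall a u v, U u -> U v -> U (a *: u + v)) ->
    (forall g u, S g -> U u -> U (rho g u)) ->
    (exists v, ~ U v) -> forall u, U u -> u = 0.
Proof.
move=> U0 Ul UT [v Uv] u Uu.
have [_ /(_ U (@subsetT _ _) U0 Ul UT)[]e] := rho_simple; first by rewrite e in Uu.
by case: Uv; rewrite e.
Qed.

Lemma simple_eqT (U : set V) : U 0 ->
    (forall a u v, U u -> U v -> U (a *: u + v)) ->
    (forall g u, S g -> U u -> U (rho g u)) ->
    (exists u, u <> 0 /\ U u) -> forall v, U v.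
Proof.
move=> U0 Ul UT [u [u0 Uu]] v.
have [_ /(_ U (@subsetT _ _) U0 Ul UT)[]e] := rho_simple; last by rewrite e.
by case: u0; rewrite e in Uu.
Qed.

End Simple.

(** Schur's lemma in its elementary form: kernel and image are invariant. *)
Lemma simple_bijective (K : fieldType) (T : Type) (S : set T) (V W : lmodType K)
    (rho : T -> V -> V) (rho' : T -> W -> W) (A : V -> W) :
  irreducible_on S rho setT -> irreducible_on S rho' setT ->
  (forall g, S g -> linear (rho' g)) -> linear A ->
  (forall g v, S g -> A (rho g v) = rho' g (A v)) ->
  (exists v, A v <> 0) -> bijective A.
Proof.
move=> irr irr' lr' lA eqA [v Av].
apply: inj_surj_bij.
  apply: (lin_inj lA).
  apply: (simple_eq0 irr (U := [set u | A u = 0])); last by exists v.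
  - exact: lin0.
  - by move=> a u w /= u0 w0; rewrite lA u0 w0 scaler0 addr0.
  - by move=> g u Sg /= u0; rewrite eqA// u0 (lin0 (lr' _ Sg)).
apply: (simple_eqT irr' (U := [set w | exists u, A u = w])).
- by exists 0; rewrite lin0.
- by move=> a _ _ /= [u <-] [w <-]; exists (a *: u + w); rewrite lA.
- by move=> g _ Sg /= [u <-]; exists (rho g u); rewrite eqA.
- by exists (A v); split=> //; exists v.
Qed.

(** The maps [iota i] are copies of [X] in [V].  Take the least [n] such that a
    nonzero vector of the image of [J] lies in a sum of [n] of them: then that
    image embeds into the quotient of the sum by its first [n - 1] copies, and
    the quotient is again a copy of [X]. *)
Lemma simple_sub_isotypic (K : fieldType) (T : Type) (S : set T)
    (V X Z : lmodType K) (rhoV : T -> V -> V) (rhoX : T -> X -> X)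
    (rhoZ : T -> Z -> Z) (I : Type) (iota : I -> X -> V) (J : Z -> V) :
  irreducible_on S rhoZ setT -> irreducible_on S rhoX setT ->
  (forall g, S g -> linear (rhoV g)) -> (forall g, S g -> linear (rhoX g)) ->
  (forall i, linear (iota i)) ->
  (forall i g x, S g -> iota i (rhoX g x) = rhoV g (iota i x)) ->
  linear J -> (forall g z, S g -> J (rhoZ g z) = rhoV g (J z)) ->
  (exists z, J z <> 0) ->
  (forall v, exists s : seq (I * X), v = \sum_(p <- s) iota p.1 p.2) ->
  exists A : Z -> X, [/\ linear A, bijective A &
    forall g z, S g -> A (rhoZ g z) = rhoX g (A z)].
Proof.
move=> irrZ irrX lV lX li eqi lJ eqJ [z0 Jz0] gen.
have [s es] := gen (J z0).
have [i [n [z [Jz [x ex]]]]] : exists (i : nat -> I) n z, J z <> 0 /\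
    exists x : nat -> X, J z = \sum_(k < n) iota (i k) (x k).
  case: s es Jz0 => [->|p s es Jz0]; first by rewrite big_nil.
  exists (fun k => (nth p (p :: s) k).1), (size (p :: s)), z0; split=> //.
  by exists (fun k => (nth p (p :: s) k).2); rewrite es (big_nth p) big_mkord.
elim: n z Jz x ex {s es z0 Jz0} => [|n IHn] z Jz x ex.
  by case: Jz; rewrite ex big_ord0.
(* [Y] is the sum of the first [n] copies. *)
pose Y := [set v | exists x : nat -> X,
  v = \sum_(k < n) iota (i k) (x k)].
have [[z' [Jz' [x' ex']]]|noY] := pselect (exists z', J z' <> 0 /\ Y (J z')).
  exact: (IHn z' Jz' x' ex').
have Y0 : Y 0.
  by exists (fun=> 0); rewrite big1// => k _; rewrite lin0.
have Yl a u v : Y u -> Y v -> Y (a *: u + v).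
  move=> [xu ->] [xv ->]; exists (fun k => a *: xu k + xv k).
  rewrite scaler_sumr -big_split; apply: eq_bigr => k _; exact/esym/li.
have YS g v : S g -> Y v -> Y (rhoV g v).
  move=> Sg [xv ->]; exists (fun k => rhoX g (xv k)).
  by rewrite (lin_sum (lV _ Sg)); apply: eq_bigr => k _; rewrite eqi.
have YB u v : Y u -> Y v -> Y (u - v).
  by move=> Yu Yv; have := Yl (-1) v u Yv Yu; rewrite scaleN1r addrC.
have JY0 z1 : Y (J z1) -> z1 = 0.
  apply: (simple_eq0 irrZ (U := [set z1 | Y (J z1)])).
  - by rewrite /= lin0.
  - by move=> a u v /= Yu Yv; rewrite lJ; apply: Yl.
  - by move=> g u Sg /= Yu; rewrite eqJ//; apply: YS.
  - by exists z => Yz; apply: noY; exists z.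
have ex1 : Y (J z - iota (i n) (x n)).
  by exists x; rewrite ex big_ord_recr /= addrK.
have exA z1 : exists x1, Y (J z1 - iota (i n) x1).
  apply: (simple_eqT irrZ (U := [set z1 | exists x1, Y (J z1 - iota (i n) x1)])) z1.
  - by exists 0; rewrite (lin0 lJ) (lin0 (li _)) subr0.
  - move=> a u v /= [xu Yu] [xv Yv]; exists (a *: xu + xv).
    by rewrite lJ li opprD addrACA -scalerBr; apply: Yl.
  - move=> g u Sg /= [xu Yu]; exists (rhoX g xu).
    by rewrite eqJ// eqi// -(linB (lV _ Sg)); apply: YS.
  - by exists z; split; [move=> e; apply: Jz; rewrite e lin0|exists (x n)].
have iY0 x1 : Y (iota (i n) x1) -> x1 = 0.
  apply: (simple_eq0 irrX (U := [set x1 | Y (iota (i n) x1)])).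
  - by rewrite /= lin0.
  - by move=> a u v /= Yu Yv; rewrite li; apply: Yl.
  - by move=> g u Sg /= Yu; rewrite eqi//; apply: YS.
  - exists (x n) => Yx; apply: Jz; rewrite (JY0 z) ?lin0//.
    by have := Yl 1 _ _ ex1 Yx; rewrite scale1r subrK.
have [A AP] := choice exA.
have Auniq z1 x1 : Y (J z1 - iota (i n) x1) -> A z1 = x1.
  move=> Yx1; apply/subr0_eq/iY0; rewrite (linB (li (i n))).
  by have := YB _ _ Yx1 (AP z1); rewrite opprB addrC addrA subrK.
have lA : linear A.
  move=> a u v; apply: Auniq.
  by rewrite lJ li opprD addrACA -scalerBr; apply: Yl.
have eqA g z1 : S g -> A (rhoZ g z1) = rhoX g (A z1).
  by move=> Sg; apply: Auniq; rewrite eqJ// eqi// -(linB (lV _ Sg)); apply: YS.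
exists A; split=> //.
apply: (simple_bijective irrZ irrX lX lA eqA).
exists z => Az0; apply: Jz; rewrite (JY0 z) ?lin0//.
by have := AP z; rewrite Az0 lin0// subr0.
Qed.

(** * Schur's lemma in countable dimension *)

Section PolyAction.
Variables (K : fieldType) (V : lmodType K) (A : V -> V).
Hypothesis A_lin : linear A.

Definition poly_act (p : {poly K}) (v : V) : V :=
  \sum_(i < size p) p`_i *: iter i A v.

Lemma poly_act_wide N (p : {poly K}) v : (size p <= N)%N ->
  poly_act p v = \sum_(i < N) p`_i *: iter i A v.
Proof.
move=> pN; rewrite /poly_act (big_ord_widen N (fun i => p`_i *: iter i A v) pN).
rewrite big_mkcond; apply: eq_bigr => i _; case: ltnP => // pi.
by rewrite nth_default// scale0r.
Qed.

Lemma poly_act_lin p : linear (poly_act p).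
Proof.
have iter_lin n : linear (iter n A).
  by elim: n => [//|n IHn] a u v /=; rewrite IHn A_lin.
move=> a u v; rewrite /poly_act scaler_sumr -big_split; apply: eq_bigr => i _.
by rewrite iter_lin scalerDr !scalerA mulrC.
Qed.

Lemma poly_act_comm p v : poly_act p (A v) = A (poly_act p v).
Proof.
rewrite /poly_act (lin_sum A_lin); apply: eq_bigr => i _.
by rewrite (linZ A_lin) -iterS iterSr.
Qed.

Lemma poly_actD p q v : poly_act (p + q) v = poly_act p v + poly_act q v.
Proof.
rewrite !(@poly_act_wide (maxn (size p) (size q))) ?leq_maxl ?leq_maxr//; last first.
  exact: size_polyD.
by rewrite -big_split; apply: eq_bigr => i _; rewrite coefD scalerDl.
Qed.

Lemma poly_actZ c p v : poly_act (c *: p) v = c *: poly_act p v.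
Proof.
rewrite !(@poly_act_wide (size p)) ?size_scale_leq// scaler_sumr.
by apply: eq_bigr => i _; rewrite coefZ scalerA.
Qed.

Lemma poly_act_sum (I : Type) (s : seq I) (F : I -> {poly K}) v :
  poly_act (\sum_(i <- s) F i) v = \sum_(i <- s) poly_act (F i) v.
Proof.
elim/big_rec2: _ => [|i q p _ <-]; last by rewrite poly_actD.
by rewrite /poly_act size_poly0 big_ord0.
Qed.

Lemma poly_act1 v : poly_act 1 v = v.
Proof. by rewrite /poly_act size_poly1 big_ord1 coef1 scale1r. Qed.

Lemma poly_actMX p v : poly_act (p * 'X) v = A (poly_act p v).
Proof.
rewrite (@poly_act_wide (size p).+1); last first.
  by have [->|p0] := eqVneq p 0; rewrite ?mul0r ?size_poly0// size_mulX.
rewrite big_ord_recl coefMX /= scale0r add0r (lin_sum A_lin).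
by apply: eq_bigr => i _; rewrite coefMX /= (linZ A_lin).
Qed.

Lemma poly_actMXsubC p b v :
  poly_act (p * ('X - b%:P)) v = A (poly_act p v) - b *: poly_act p v.
Proof.
by rewrite mulrBr mulrC -[_ * b%:P]mulrC mul_polyC -scaleNr poly_actD poly_actZ
  mulrC poly_actMX scaleNr.
Qed.

End PolyAction.

(** Dixmier's argument.  If no [A - a] vanishes, all of them are invertible,
    and the vectors [(A - a)^-1 v], for fixed [v != 0], form an uncountable
    family.  In countable dimension infinitely many of them lie in one
    finite-dimensional subspace, so they satisfy a linear relation; clearing
    denominators, [P(A) v = 0] for a nonzero polynomial [P].  Since [P] splits,
    this contradicts the injectivity of all [A - a]. *)
Lemma schur_countable_dim (K : closedFieldType) (T : Type) (S : set T)
    (V : lmodType K) (rho : T -> V -> V) (e : nat -> V) (A : V -> V) :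
  ~ countable [set: K] -> irreducible_on S rho setT ->
  (forall g, S g -> linear (rho g)) ->
  (forall v, exists n (c : nat -> K), v = \sum_(k < n) c k *: e k) ->
  linear A -> (forall g v, S g -> A (rho g v) = rho g (A v)) ->
  exists a, forall v, A v = a *: v.
Proof.
move=> Kunc irr lr gen lA eqA; apply: contrapT => noscal.
have bijA a : bijective (fun v => A v - a *: v).
  apply: (simple_bijective irr irr lr).
  - by move=> b u v; rewrite lA scalerDr opprD addrACA scalerBr !scalerA (mulrC b).
  - move=> g v Sg; rewrite eqA// -(linZ (lr g Sg)) -(linB (lr g Sg))//.
  - apply: contrapT => /forallNP h; apply: noscal; exists a => v.
    by have /contrapT/subr0_eq := h v.
have injA a v : A v - a *: v = 0 -> v = 0.
  move=> e0; apply: (bij_inj (bijA a)); rewrite e0.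
  by rewrite (lin0 lA) scaler0 subr0.
have [[v _ /eqP v0] _] := irr.
have /choice[B BP] a : exists w, A w - a *: w = v.
  by have [g _ gK] := bijA a; exists (g v); rewrite gK.
have /choice[n /choice[c cP]] a : exists n (c : nat -> K),
  B a = \sum_(k < n) c k *: e k by exact: gen.
(* [c a] are coordinates of [(A - a)^-1 v] on the first [n a] vectors of [e];
   the field is not a countable union of finite sets. *)
have [d infd] : exists d, infinite_set [set a | n a = d].
  apply: contrapT => /forallNP fin; apply: Kunc.
  have -> : [set: K] = \bigcup_(d in [set: nat]) [set a | n a = d].
    by apply/seteqP; split=> // a _; exists (n a).
  apply: bigcup_countable => // d _; apply: finite_set_countable.
  exact: contrapT (fin d).
have [E Ed dE] := infinite_set_fset d.+1 infd.
pose a (j : 'I_d.+1) := nth 0 (finmap.enum_fset E) j.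
have aE j : a j \in finmap.enum_fset E by apply/mem_nth/(leq_trans (ltn_ord j)).
have aI : injective a.
  move=> i j /eqP; rewrite nth_uniq ?finmap.fset_uniq//; first by move/eqP/val_inj.
    exact: leq_trans (ltn_ord i) dE.
  exact: leq_trans (ltn_ord j) dE.
have an i : n (a i) = d by exact: (Ed _ (aE i)).
pose M := \matrix_(j < d.+1, k < d) c (a j) k.
have /rowV0Pn[u] : kermx M != 0.
  rewrite -mxrank_eq0 mxrank_ker subn_eq0 -ltnNge ltnS; exact: rank_leq_col.
move=> /sub_kermxP uM u0.
have dep : \sum_(j < d.+1) u 0 j *: B (a j) = 0.
  under eq_bigr => j _ do rewrite cP an scaler_sumr.
  rewrite exchange_big big1//= => k _.
  have := congr1 (fun w : 'rV_d => w 0 k) uM; rewrite !mxE => uk0.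
  rewrite -[RHS](scale0r (e k)) -uk0 scaler_suml; apply: eq_bigr => j _.
  by rewrite scalerA mxE.
pose Q j := \prod_(l < d.+1 | l != j) ('X - (a l)%:P).
pose P := \sum_(j < d.+1) u 0 j *: Q j.
(* At [a j], only the [j]-th term of [P] does not vanish. *)
have P0 : P != 0.
  have [j uj0] : exists j, u 0 j != 0.
    apply: contrapT => /forallNP h; case/eqP: u0; apply/rowP => j.
    by rewrite mxE; apply/eqP/negPn/negP/h.
  apply: contra_neq uj0 => P0; have := congr1 (fun p => p.[a j]) P0.
  rewrite horner0 horner_sum (bigD1 j)//= big1 ?addr0.
    move=> /eqP; rewrite hornerZ mulf_eq0 => /orP[/eqP//|].
    rewrite horner_prod => /prodf_eq0[l lj].
    by rewrite hornerXsubC subr_eq0 => /eqP/aI jl; rewrite jl eqxx in lj.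
  move=> i ij; rewrite hornerZ horner_prod (bigD1 j) 1?eq_sym//=.
  by rewrite hornerXsubC subrr mul0r mulr0.
(* [Q j] applied to [v = (A - a_j) B(a_j)] is the full product applied to
   [B(a_j)]. *)
have Pv : poly_act A P v = 0.
  rewrite poly_act_sum.
  under eq_bigr => j _.
    rewrite poly_actZ -[X in poly_act _ _ X](BP (a j)) (linB (poly_act_lin lA _)).
    rewrite (linZ (poly_act_lin lA _)) poly_act_comm// -poly_actMXsubC//.
    rewrite -(linZ (poly_act_lin lA _)).
    have -> : Q j * ('X - (a j)%:P) = \prod_(l < d.+1) ('X - (a l)%:P).
      by rewrite [RHS](bigD1 j)//= mulrC.
    over.
  by rewrite -(lin_sum (poly_act_lin lA _)) dep (lin0 (poly_act_lin lA _)).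
have [rs Prs] := closed_field_poly_normal P.
have act_inj : forall s w, poly_act A (\prod_(z <- s) ('X - z%:P)) w = 0 -> w = 0.
  elim=> [|z s IHs] w; first by rewrite big_nil poly_act1.
  by rewrite big_cons mulrC poly_actMXsubC// => /injA/IHs.
move: Pv; rewrite Prs poly_actZ => /eqP; rewrite scaler_eq0 lead_coef_eq0 (negPf P0).
by move=> /eqP/act_inj.
Qed.

(** A countable set is negligible, and the unit interval has measure 1. *)
Lemma complex_uncountable (R : realType) : ~ countable [set: R[i]].
Proof.
move=> /countable_injP[f fI].
have cR : countable `[0%R : R, 1]%classic.
  apply/countable_injP; exists (fun x => f x%:C%C) => x y _ _ /fI.
  by rewrite !inE => /(_ I I)[].
have := countable_lebesgue_measure0 cR.
rewrite lebesgue_measure_itv /= lte01 oppr0 adde0 => /eqP.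
by rewrite onee_eq0.
Qed.

(** * Linear functionals and coherent families of isomorphisms *)

(** Zorn's lemma gives a subspace maximal among those which contain [U] and
    avoid [v]; the line of [v] is then a complement of it. *)
Lemma separating_functional (K : fieldType) (V : lmodType K) (U : set V) (v : V) :
  U 0 -> (forall a u w, U u -> U w -> U (a *: u + w)) -> ~ U v ->
  exists f : V -> K^o, [/\ linear f, forall u, U u -> f u = 0 & f v = 1].
Proof.
move=> U0 Ul Uv.
(* The empty set is let in because it is the union of the empty chain. *)
pose P (A : set V) := [/\ forall a u w, A u -> A w -> A (a *: u + w), ~ A v &
  (exists u, A u) -> U `<=` A].
have [|A [[Al Av AU] Amax]] := @Zorn_bigcup _ P.
  move=> F FP Ftot; split.
  - move=> a u w [X FX Xu] [Y FY Yw].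
    have [XY|YX] := Ftot _ _ FX FY.
      by exists Y => //; have [Yl _ _] := FP _ FY; apply: Yl => //; apply: XY.
    by exists X => //; have [Xl _ _] := FP _ FX; apply: Xl => //; apply: YX.
  - by move=> [X FX Xv]; have [_ /(_ Xv)] := FP _ FX.
  - move=> [u [X FX Xu]] w Uw; exists X => //.
    by have [_ _ /(_ (ex_intro _ u Xu))] := FP _ FX; apply.
have Ane : exists u, A u.
  apply: contrapT => noA; apply: (Amax U); last by split=> // _.
  rewrite properEneq; split; last by move=> u Au; case: noA; exists u.
  by apply/eqP => AU0; apply: noA; exists 0; rewrite AU0.
have {}AU := AU Ane.
have A0 : A 0 by exact: AU.
have AZ a u : A u -> A (a *: u) by move=> Au; rewrite -[_ *: _]addr0; apply: Al.
have AB u w : A u -> A w -> A (u - w).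
  by move=> Au Aw; rewrite addrC -scaleN1r; apply: Al.
have dec w : exists c, A (w - c *: v).
  have [Aw|nAw] := pselect (A w); first by exists 0; rewrite scale0r subr0.
  pose B := [set x | exists c, A (x - c *: w)].
  have AB' : A `<` B.
    rewrite properEneq; split.
      apply/eqP => AeB; apply: nAw; rewrite AeB; exists 1.
      by rewrite scale1r subrr.
    by move=> x Ax; exists 0; rewrite scale0r subr0.
  have [c Ac] : B v.
    apply: contrapT => nBv; apply: (Amax _ AB'); split=> //.
      move=> a x y [c Ac] [d Ad]; exists (a * c + d).
      by rewrite scalerDl opprD addrACA -scalerA -scalerBr; apply: Al.
    by move=> _ x Ux; apply: AB'.1; apply: AU.
  have c0 : c != 0.
    by apply/eqP => c0; apply: Av; rewrite c0 scale0r subr0 in Ac.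
  exists c^-1.
  have -> : w - c^-1 *: v = -1 *: (c^-1 *: (v - c *: w)).
    by rewrite scalerBr scalerK// scaleN1r opprB.
  exact/AZ/AZ.
have /choice[f fP] := dec.
have fE w c : A (w - c *: v) -> f w = c.
  move=> Ac; apply: contrapT => /eqP fc; apply: Av.
  rewrite -[v](@scalerK _ _ (f w - c)) ?subr_eq0//; apply: AZ.
  have := AB _ _ Ac (fP w).
  by rewrite opprB addrC addrA subrK -scalerBl.
exists f; split.
- move=> a u w; apply: fE.
  by rewrite scalerDl opprD addrACA -[in X in _ - X](scalerA a) -scalerBr; apply: Al.
- by move=> u Uu; apply: fE; rewrite scale0r subr0; apply: AU.
- by apply: fE; rewrite scale1r subrr.
Qed.

(** [iso i j e A] says that [A] is an isomorphism from the [i]-th representation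
    to the [j]-th one ([e = false]), or from its dual ([e = true]).  By Schur's
    lemma such isomorphisms compose up to scalars.  They can be normalized so
    as to compose exactly: in each class fix a representative [c], and one
    isomorphism from [c] to each member; the only remaining choice is that of a
    self-duality of [c], whose square can be made equal to [1] since scalars
    have square roots.  In other words, a central extension of a group of order
    at most [2] by the multiplicative group of an algebraically closed field
    splits. *)
Lemma coherent_isos (K : closedFieldType) (I : finType) (Vs : I -> lmodType K)
    (iso : forall i j, bool -> (Vs i -> Vs j) -> Prop) :
  (forall i j e A, iso i j e A -> linear A) ->
  (forall i j e A, iso i j e A -> bijective A) ->
  (forall i, iso i i false id) ->
  (forall i j k e d A B, iso i j e A -> iso j k d B -> iso i k (e (+) d) (B \o A)) ->
  (forall i j e A B, iso i j e A -> cancel A B -> cancel B A -> iso j i e B) ->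
  (forall i j e a A, a != 0 -> iso i j e A -> iso i j e (fun v => a *: A v)) ->
  (forall i A, iso i i false A -> exists a, forall v, A v = a *: v) ->
  exists A : forall i j, bool -> Vs i -> Vs j,
    (forall i j e, (exists B, iso i j e B) -> iso i j e (A i j e)) /\
    (forall i j k e d v, (exists B, iso i j e B) -> (exists B, iso j k d B) ->
       A j k d (A i j e v) = A i k (e (+) d) v).
Proof.
move=> iso_lin iso_bij iso_id iso_comp iso_inv iso_scale schur.
pose eqv i j := exists e B, iso i j e B.
have eqv_refl i : eqv i i by exists false, id.
have eqv_sym i j : eqv i j -> eqv j i.
  move=> [e [B isoB]]; have [C BK CK] := iso_bij _ _ _ _ isoB.
  by exists e, C; apply: iso_inv BK CK.
have eqv_trans i j k : eqv i j -> eqv j k -> eqv i k.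
  by move=> [e [B isoB]] [d [C isoC]]; exists (e (+) d), (C \o B); apply: iso_comp isoB isoC.
have HB c j : exists z : bool * (Vs c -> Vs j) * (Vs j -> Vs c),
    eqv c j -> [/\ iso c j z.1.1 z.1.2, cancel z.1.2 z.2 & cancel z.2 z.1.2].
  have [[e [B isoB]]|ncj] := pselect (eqv c j).
    by have [C BK CK] := iso_bij _ _ _ _ isoB; exists (e, B, C).
  by exists (false, fun=> 0, fun=> 0) => /ncj.
have HS c : exists S : Vs c -> Vs c, (exists B, iso c c true B) ->
    iso c c true S /\ involutive S.
  have [[B isoB]|nc] := pselect (exists B, iso c c true B); last by exists id => /nc.
  have [a aP] := schur c _ (iso_comp _ _ _ _ _ _ _ isoB isoB).
  (* The scalar vanishes only if the space does. *)
  have [a0|a0] := eqVneq a 0.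
    exists B => _; split=> // v.
    have B0 x : B (B x) = 0 by have := aP x; rewrite a0 scale0r.
    have V0 (x : Vs c) : x = 0.
      have Binj := bij_inj (iso_bij _ _ _ _ isoB).
      by apply: (Binj); apply: (Binj); rewrite !B0.
    by rewrite [LHS]V0 [RHS]V0.
  have [b b2] : exists b : K, b ^+ 2 = a^-1.
    have [b] := @solve_monicpoly K 2 (fun i => if i is 0%N then a^-1 else 0) isT.
    rewrite !big_ord_recl big_ord0 /= expr0 mulr1 mul0r !addr0 => b2.
    by exists b.
  have b0 : b != 0.
    apply/eqP => b0; move: b2; rewrite b0 expr0n /= => /esym/eqP.
    by rewrite invr_eq0 (negPf a0).
  exists (fun v => b *: B v) => _; split; first exact: iso_scale.
  move=> v; rewrite (linZ (iso_lin _ _ _ _ isoB)) scalerA -expr2 b2.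
  by have /= -> := aP v; rewrite scalerK.
pose s c j := (projT1 (cid (HB c j))).1.1.
pose to c j := (projT1 (cid (HB c j))).1.2.
pose from c j := (projT1 (cid (HB c j))).2.
have toP c j : eqv c j -> [/\ iso c j (s c j) (to c j), cancel (to c j) (from c j) &
    cancel (from c j) (to c j)] by exact: projT2 (cid (HB c j)).
pose S c := projT1 (cid (HS c)).
have SP c : (exists B, iso c c true B) -> iso c c true (S c) /\ involutive (S c).
  exact: projT2 (cid (HS c)).
pose Sp c e := if e then S c else id.
(* Go back to the representative, apply the self-duality if the sign requires
   it, and come to [j]. *)
pose A0 c i j e (v : Vs i) : Vs j := to c j (Sp c (s c i (+) e (+) s c j) (from c i v)).
(* [pick] depends only on the class of [j]. *)
pose rep j := odflt j [pick i | `[<eqv i j>]].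
have repP j : eqv (rep j) j.
  by rewrite /rep; case: pickP => [i /asboolP//|].
have rep_eq i j : eqv i j -> rep i = rep j.
  move=> eij; rewrite /rep; have : [pick k | `[<eqv k i>]] = [pick k | `[<eqv k j>]].
    apply: eq_pick => k; apply: asbool_equiv_eq; split=> [ki|kj].
      exact: eqv_trans eij.
    exact: eqv_trans kj (eqv_sym _ _ eij).
  by move=> ->; case: pickP => // /(_ j)/asboolP; case.
have from_iso c i : eqv c i -> iso i c (s c i) (from c i).
  by move=> /toP[isoB BK CK]; exact: iso_inv isoB BK CK.
have self c i j e : eqv c i -> (exists B, iso i j e B) ->
    exists B, iso c c (s c i (+) e (+) s c j) B.
  move=> ci [B isoB]; have cj : eqv c j by apply: eqv_trans ci _; exists e, B.
  have [isoi _ _] := toP _ _ ci.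
  exists (from c j \o (B \o to c i)).
  exact: (iso_comp _ _ _ _ _ _ _ (iso_comp _ _ _ _ _ _ _ isoi isoB) (from_iso _ _ cj)).
have Sp_iso c e : (exists B, iso c c e B) -> iso c c e (Sp c e).
  by case: e => [/SP[]//|_]; exact: iso_id.
exists (fun i j => A0 (rep i) i j); split=> [i j e ex|i j k e d v exB exC].
  have ri := repP i; set c := rep i in ri *.
  have rj : eqv c j by apply: eqv_trans ri _; exists e.
  have [isoj _ _] := toP _ _ rj.
  have -> : e = s c i (+) (s c i (+) e (+) s c j) (+) s c j.
    by rewrite !addbA addbb addFb -addbA addbb addbF.
  have -> : A0 c i j (s c i (+) (s c i (+) e (+) s c j) (+) s c j) =
      to c j \o (Sp c (s c i (+) e (+) s c j) \o from c i).
    apply: funext => v /=; rewrite /A0; congr (to c j (Sp c _ _)).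
    by rewrite !addbA addbb addFb -!addbA addbb addbF.
  have isoS := Sp_iso _ _ (self _ _ _ _ ri ex).
  exact: (iso_comp _ _ _ _ _ _ _ (iso_comp _ _ _ _ _ _ _ (from_iso _ _ ri) isoS) isoj).
have sgn (x y z e1 d1 : bool) :
    x (+) (e1 (+) d1) (+) z = (x (+) e1 (+) y) (+) (y (+) d1 (+) z).
  by case: x; case: y; case: z; case: e1; case: d1.
have eij : eqv i j by exists e.
rewrite -(rep_eq _ _ eij).
have ri := repP i; set c := rep i in ri *.
have rj := eqv_trans _ _ _ ri eij.
have [_ toK _] := toP _ _ rj.
rewrite /A0 toK; congr (to c k _).
have := self _ _ _ _ rj exC; have := self _ _ _ _ ri exB.
rewrite (sgn _ (s c j)).
case: (s c i (+) e (+) s c j); case: (s c j (+) d (+) s c k) => //= _.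
by move=> /SP[_ ->].
Qed.

(** * Tensor products and their factors *)

(** The axiomatics of one factor [X] of a tensor product [V]: [P] indexes pure
    tensors of the other factors, and [iota p] inserts a vector of [X] into the
    pure tensor [p].  The third condition is what contractions against
    functionals on the other factors provide: inside [V], they separate vectors
    of [X] from subspaces of [X]. *)
Record is_factor (K : fieldType) (P : Type) (X V : lmodType K)
    (iota : P -> X -> V) : Prop := IsFactor {
  factor_lin : forall p, linear (iota p);
  factor_gen : forall v, exists s : seq (P * X), v = \sum_(q <- s) iota q.1 q.2;
  factor_sep : forall (U : set X) (u : X), U 0 ->
    (forall a x y, U x -> U y -> U (a *: x + y)) -> ~ U u ->
    exists p, exists F : V -> K^o, [/\ linear F, F (iota p u) <> 0 &
      forall p' x, U x -> F (iota p' x) = 0];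
  factor_map : forall E : X -> X, linear E ->
    exists F : V -> V, linear F /\ forall p u, F (iota p u) = iota p (E u)
}.

Section FactorRepresentation.
Variables (K : fieldType) (P : Type) (X V : lmodType K) (iota : P -> X -> V).
Hypothesis iota_factor : is_factor iota.
Variables (T0 T : Type) (S0 : set T0) (S : set T).
Variables (sigma : T0 -> V -> V) (rho : T -> X -> X).
Hypothesis sigma_lin : forall g, S0 g -> linear (sigma g).
Hypothesis sigma_iota : forall g, S0 g -> exists2 h, S h &
  forall p, exists p', forall u, sigma g (iota p u) = iota p' (rho h u).

(** If [U] is an invariant subspace of the factor, the span of the [iota p u],
    [u] in [U], is invariant in [V], and proper if [U] is. *)
Lemma factor_simple : irreducible_on S0 sigma setT -> irreducible_on S rho setT.
Proof.
move=> irr; have [li gen sep _] := iota_factor.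
split.
  have [[v _ v0] _] := irr; apply: contrapT => noX.
  have [s es] := gen v; case/eqP: v0; rewrite es big1// => q _.
  have -> : q.2 = 0 by apply/eqP/negPn/negP => q0; apply: noX; exists q.2.
  by rewrite lin0.
move=> U _ U0 Ul US.
have [[u [u0 Uu]]|noU] := pselect (exists u, u <> 0 /\ U u); last first.
  left; apply/seteqP; split=> [u Uu|_ ->//]; apply: contrapT => u0.
  by apply: noU; exists u.
right; apply/seteqP; split=> // w _; apply: contrapT => Uw.
have UZ a x : U x -> U (a *: x) by move=> Ux; rewrite -[_ *: _]addr0; apply: Ul.
pose scale a (x : {x | U x}) : {x | U x} := exist _ _ (UZ a _ (svalP x)).
pose Y := [set v | exists s : seq (P * {x | U x}), v = \sum_(q <- s) iota q.1 (sval q.2)].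
have YT : forall v, Y v.
  apply: (simple_eqT irr).
  - by exists [::]; rewrite big_nil.
  - move=> a _ _ [s ->] [s' ->]; exists (map (fun q => (q.1, scale a q.2)) s ++ s').
    rewrite big_cat big_map scaler_sumr /=; congr (_ + _); apply: eq_bigr => q _.
    by rewrite (linZ (li _)).
  - move=> g _ S0g [s ->]; have [h Sh /choice[f fP]] := sigma_iota S0g.
    pose act (x : {x | U x}) : {x | U x} := exist _ _ (US _ _ Sh (svalP x)).
    exists (map (fun q => (f q.1, act q.2)) s).
    by rewrite (lin_sum (sigma_lin S0g)) big_map; apply: eq_bigr => q _; rewrite fP.
  - have [p [F [lF Fu _]]] : exists p, exists F : V -> K^o,
        [/\ linear F, F (iota p u) <> 0 &
        forall p' x, [set (0 : X)] x -> F (iota p' x) = 0].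
      by apply: sep => // a _ _ -> ->; rewrite scaler0 addr0.
    exists (iota p u); split; first by move=> e; apply: Fu; rewrite e lin0.
    by exists [:: (p, exist _ u Uu)]; rewrite big_seq1.
have [p [F [lF Fw FU]]] := sep U w U0 Ul Uw.
have [s es] := YT (iota p w); apply: Fw; rewrite es (lin_sum lF) big1// => q _.
exact/FU/svalP.
Qed.

(** An endomorphism of the factor extends to an endomorphism of [V], which is a
    scalar. *)
Lemma factor_schur :
  (forall A : V -> V, linear A -> (forall g v, S0 g -> A (sigma g v) = sigma g (A v)) ->
     exists a, forall v, A v = a *: v) ->
  forall E : X -> X, linear E -> (forall h u, S h -> E (rho h u) = rho h (E u)) ->
    exists a, forall u, E u = a *: u.
Proof.
move=> schur E lE eqE; have [li gen sep mapi] := iota_factor.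
have [F [lF FE]] := mapi E lE.
have [|a aP] := schur F lF.
  move=> g v S0g; have [s ->] := gen v; have [h Sh fP] := sigma_iota S0g.
  rewrite (lin_sum lF) !(lin_sum (sigma_lin S0g)) (lin_sum lF).
  apply: eq_bigr => q _; have [p' e] := fP q.1.
  by rewrite e !FE e eqE.
exists a => u; apply: contrapT => /eqP; rewrite -subr_eq0 => /eqP Eu.
have [p [G [lG Gu _]]] : exists p, exists G : V -> K^o,
    [/\ linear G, G (iota p (E u - a *: u)) <> 0 &
    forall p' x, [set (0 : X)] x -> G (iota p' x) = 0].
  by apply: sep => // b _ _ -> ->; rewrite scaler0 addr0.
apply: Gu; rewrite (linB (li p)) (linZ (li p)) -FE aP subrr.
by rewrite lin0.
Qed.

End FactorRepresentation.

Lemma dual_vector (K : fieldType) (X : lmodType K) (u : X) : u <> 0 ->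
  exists f : X -> K^o, linear f /\ f u = 1.
Proof.
move=> u0; have [||//|f [lf _ fu]] := @separating_functional K X [set 0] u.
- by [].
- by move=> a _ _ -> ->; rewrite scaler0 addr0.
- by exists f.
Qed.

Lemma dual_family (K : fieldType) (I : Type) (Vs : I -> lmodType K)
    (x : forall i, Vs i) : (forall i, x i <> 0) ->
  exists fs : forall i, Vs i -> K^o, forall i, linear (fs i) /\ fs i (x i) = 1.
Proof.
move=> x0; exists (fun i => projT1 (cid (dual_vector (x0 i)))) => i.
exact: projT2 (cid (dual_vector (x0 i))).
Qed.

Section TensorProduct.
Variables (K : fieldType) (I : finType) (Vs : I -> lmodType K) (Vt V : lmodType K).
Variable t : (forall i, Vs i) -> Vt -> V.
Hypothesis t_tensor : is_tensor t.

Let t_multilinear : multilinear t := proj1 t_tensor.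

Lemma dfwith_id (x : forall i, Vs i) i : eqtype.dfwith x (x i) = x.
Proof.
apply: functional_extensionality_dep => j.
by case: (eqtype.dfwithP x (x i) j).
Qed.

Lemma tensor_lift (U : lmodType K) (b : (forall i, Vs i) -> Vt -> U) :
  multilinear b -> exists f : V -> U, linear f /\ forall x y, f (t x y) = b x y.
Proof.
move=> /(proj2 t_tensor)[f [fP _]]; exists f; split=> // a u v.
by rewrite linearP.
Qed.

Lemma tensor_ext (U : lmodType K) (f g : V -> U) : linear f -> linear g ->
  (forall x y, f (t x y) = g (t x y)) -> f =1 g.
Proof.
move=> lf lg fg.
have [|h [_ hP]] := (proj2 t_tensor) U (fun x y => f (t x y)).
  have [li l0] := t_multilinear; split=> [i x y c u v|x a u v]; first by rewrite li lf.
  by rewrite l0 lf.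
move=> v; rewrite -[LHS]/(linear_pack lf v) -[RHS]/(linear_pack lg v).
by rewrite !hP// => x y; rewrite fg.
Qed.

(** A functional that vanishes on pure tensors is zero, by uniqueness in the
    universal property. *)
Lemma tensor_gen v : exists s : seq ((forall i, Vs i) * Vt),
  v = \sum_(q <- s) t q.1 q.2.
Proof.
apply: contrapT => nv; have [li l0] := t_multilinear.
have [||f [lf f0 fv]] := @separating_functional K V
    [set v | exists s : seq ((forall i, Vs i) * Vt), v = \sum_(q <- s) t q.1 q.2]
    v _ _ nv.
- by exists [::]; rewrite big_nil.
- move=> a _ _ [s ->] [s' ->]; exists (map (fun q => (q.1, a *: q.2)) s ++ s').
  rewrite big_cat big_map scaler_sumr /=; congr (_ + _); apply: eq_bigr => q _.
  by rewrite (linZ (l0 _)).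
have : f v = 0.
  apply: (@tensor_ext K^o f (fun=> 0)) => //.
    by move=> a u w; rewrite scaler0 addr0.
  by move=> x y; apply: f0; exists [:: (x, y)]; rewrite big_seq1.
by rewrite fv => /eqP; rewrite oner_eq0.
Qed.

Lemma tensor_scale (c : I -> K) x y :
  t (fun i => c i *: x i) y = (\prod_i c i) *: t x y.
Proof.
have [li _] := t_multilinear.
(* The factors are rescaled one after the other, along [s]. *)
have partial (s : seq I) : uniq s ->
    t (fun i => if i \in s then c i *: x i else x i) y = (\prod_(i <- s) c i) *: t x y.
  elim: s => [|a s IHs] /=; first by rewrite big_nil scale1r.
  move=> /andP[as_ /IHs{}IHs]; rewrite big_cons -scalerA -IHs.
  set f := fun i => if i \in s then c i *: x i else x i.
  have -> : (fun i => if i \in a :: s then c i *: x i else x i) =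
      eqtype.dfwith f (c a *: x a).
    apply: functional_extensionality_dep => i; have [<-|ai] := eqVneq a i.
      by rewrite eqtype.dfwith_in mem_head.
    by rewrite eqtype.dfwith_out// inE eq_sym (negPf ai).
  have la : linear (fun u : Vs a => t (eqtype.dfwith f u) y) by move=> b u v; rewrite li.
  rewrite (linZ la); congr (_ *: t _ _).
  by have := dfwith_id f a; rewrite {2}/f (negPf as_).
rewrite -(partial _ (index_enum_uniq I)); congr (t _ _).
by apply: functional_extensionality_dep => i; rewrite mem_index_enum.
Qed.

Lemma tensor_contraction (fs : forall i, Vs i -> K^o) (f0 : Vt -> K^o) :
  (forall i, linear (fs i)) -> linear f0 ->
  exists F : V -> K^o, linear F /\
    forall x y, F (t x y) = (\prod_i (fs i (x i) : K)) * f0 y.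
Proof.
move=> lfs lf0; apply: tensor_lift; split=> [i x y c u v|x a u v]; last first.
  by rewrite lf0 mulrDr; congr (_ + _); rewrite [LHS]mulrCA.
have E w : (\prod_j (fs j (eqtype.dfwith x w j) : K)) * f0 y =
    (fs i w : K) * ((\prod_(j | j != i) (fs j (x j) : K)) * f0 y).
  rewrite (bigD1 i)//= eqtype.dfwith_in -mulrA; congr (_ * (_ * _)).
  by apply: eq_bigr => j ji; rewrite eqtype.dfwith_out// eq_sym.
rewrite !E lfs mulrDl; congr (_ + _).
by rewrite -[LHS]mulrA.
Qed.

Lemma tensor_map (pi pi' : I -> I) (A : forall k, Vs (pi k) -> Vs k) (A0 : Vt -> Vt) :
  cancel pi pi' -> cancel pi' pi -> (forall k, linear (A k)) -> linear A0 ->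
  exists F : V -> V, linear F /\
    forall x y, F (t x y) = t (fun k => A k (x (pi k))) (A0 y).
Proof.
move=> piK pi'K lA lA0; have [li l0] := t_multilinear.
apply: tensor_lift; split=> [i x y|x a u v]; last by rewrite lA0 l0.
rewrite -(pi'K i); set k := pi' i => c u v.
have E w : (fun j => A j (eqtype.dfwith x w (pi j))) =
    eqtype.dfwith (fun j => A j (x (pi j))) (A k w).
  apply: functional_extensionality_dep => j; have [->|jk] := eqVneq j k.
    by rewrite !eqtype.dfwith_in.
  by rewrite !eqtype.dfwith_out ?(can_eq piK)// eq_sym.
by rewrite !E lA li.
Qed.

Hypothesis V_neq0 : exists v : V, v != 0.

Lemma tensor_nonzero_factors : exists x y,
  [/\ t x y <> 0, forall i, x i <> 0 & y <> 0].
Proof.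
have [li l0] := t_multilinear; have [v v0] := V_neq0.
have [x [y txy]] : exists x y, t x y <> 0.
  apply: contrapT => h; case/eqP: v0.
  have [s ->] := tensor_gen v; rewrite big1// => q _.
  by apply: contrapT => tq; apply: h; exists q.1, q.2.
exists x, y; split=> // [i xi|y0]; apply: txy; last by rewrite y0 (lin0 (l0 _)).
have li0 : linear (fun u : Vs i => t (eqtype.dfwith x u) y) by move=> a u w; rewrite li.
by rewrite -(dfwith_id x i) xi (lin0 li0).
Qed.

Lemma tensor_neq0 x y : (forall i, x i <> 0) -> y <> 0 -> t x y <> 0.
Proof.
move=> /dual_family[fs fsP] /dual_vector[f0 [lf0 f0y]].
have [F [lF FE]] := tensor_contraction (fun i => proj1 (fsP i)) lf0.
move=> txy; have := FE x y; rewrite txy (lin0 lF) f0y mulr1 big1.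
  by move=> /esym/eqP; rewrite oner_eq0.
by move=> i _; have [] := fsP i.
Qed.

Lemma tensor_factor i : is_factor
  (fun (q : (forall j, Vs j) * Vt) (u : Vs i) => t (eqtype.dfwith q.1 u) q.2).
Proof.
have [li l0] := t_multilinear; split.
- by move=> p a u v; rewrite li.
- move=> v; have [s ->] := tensor_gen v; exists (map (fun q => (q, q.1 i)) s).
  by rewrite big_map; apply: eq_bigr => q _ /=; rewrite dfwith_id.
- move=> U u U0 Ul Uu; have [f [lf fU fu]] := separating_functional U0 Ul Uu.
  have [x [y [_ /dual_family[fs fsP] /dual_vector[f0 [lf0 f0y]]]]] :=
    tensor_nonzero_factors.
  pose hs := eqtype.dfwith fs f.
  have [|F [lF FE]] := tensor_contraction (fs := hs) _ lf0.
    by move=> j; rewrite /hs; case: eqtype.dfwithP => // k _; have [] := fsP k.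
  exists (x, y), F; split=> //= [|p' w Uw]; rewrite FE; last first.
    by rewrite (bigD1 i)//= /hs !eqtype.dfwith_in fU// !mul0r.
  rewrite f0y mulr1 big1; first by apply/eqP; rewrite oner_eq0.
  move=> j _; rewrite /hs; have [<-|ij] := eqVneq i j; first by rewrite !eqtype.dfwith_in.
  by rewrite !eqtype.dfwith_out//; have [] := fsP j.
- move=> E lE.
  pose A k : Vs k -> Vs k := eqtype.dfwith (T := fun k => Vs k -> Vs k) (fun=> id) E k.
  have [|F [lF FE]] := @tensor_map id id A id (fun=> erefl) (fun=> erefl) _ (fun _ _ _ => erefl).
    by move=> k; rewrite /A; case: eqtype.dfwithP.
  exists F; split=> // p u; rewrite FE; congr (t _ _).
  apply: functional_extensionality_dep => k; rewrite /A.
  have [<-|ik] := eqVneq i k; first by rewrite !eqtype.dfwith_in.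
  by rewrite !eqtype.dfwith_out.
Qed.

Lemma tensor_last_factor : is_factor t.
Proof.
have [li l0] := t_multilinear; split=> //; first exact: tensor_gen.
- move=> U u U0 Ul Uu; have [f [lf fU fu]] := separating_functional U0 Ul Uu.
  have [x [y [_ /dual_family[fs fsP] _]]] := tensor_nonzero_factors.
  have [F [lF FE]] := tensor_contraction (fun i => proj1 (fsP i)) lf.
  exists x, F; split=> // [|x' w Uw]; rewrite FE; last by rewrite fU// mulr0.
  rewrite fu mulr1 big1; first by apply/eqP; rewrite oner_eq0.
  by move=> j _; have [] := fsP j.
- move=> E lE; exact: (@tensor_map id id (fun=> id) E (fun=> erefl) (fun=> erefl)).
Qed.

End TensorProduct.

(** * Local fields are separable *)

Section Separability.
Variables (F : fieldType) (ord : F -> int) (q : nat).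
Hypothesis F_local : nonarch_local_field ord q.

Let F_ordM : forall x y : F, x != 0 -> y != 0 -> ord (x * y) = ord x + ord y.
Proof. by case: F_local. Qed.

Lemma ord1 : ord 1 = 0.
Proof.
apply/eqP; rewrite -(inj_eq (addrI (ord 1))) addr0 -F_ordM ?oner_neq0//.
by rewrite mulr1.
Qed.

Lemma ord_ge_le (M N : int) x : M <= N -> ord_ge ord N x -> ord_ge ord M x.
Proof. by move=> MN [->|Nx]; [left|right; apply: le_trans Nx]. Qed.

Lemma ord_geM (M N : int) x y :
  ord_ge ord M x -> ord_ge ord N y -> ord_ge ord (M + N) (x * y).
Proof.
have [->|x0] := eqVneq x 0; first by left; rewrite mul0r.
have [->|y0] := eqVneq y 0; first by left; rewrite mulr0.
move=> [xe|Mx]; first by rewrite xe eqxx in x0.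
move=> [ye|Ny]; first by rewrite ye eqxx in y0.
by right; rewrite F_ordM// lerD.
Qed.

Lemma ord_ge_sum N (I : Type) (s : seq I) (f : I -> F) :
  (forall i, ord_ge ord N (f i)) -> ord_ge ord N (\sum_(i <- s) f i).
Proof.
move=> fN; elim/big_rec: _ => [|i x _ Nx]; first by left.
exact: (ordD F_local).
Qed.

Lemma ordX (p : F) n : p != 0 -> ord p = 1 -> ord (p ^+ n) = n.
Proof.
move=> p0 p1; elim: n => [|n IHn]; first by rewrite expr0 ord1.
by rewrite exprS F_ordM ?expf_neq0// p1 IHn -intS.
Qed.

(** The approximations are the truncated expansions in powers of a uniformizer
    [p] with digits in a finite set of residues: the code [(M, l)] stands for
    the number with the digits [l], divided by [p ^ M]. *)
Lemma local_field_separable : exists dec : nat * seq nat -> F,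
  forall x (N : int), exists c, ord_ge ord N (x - dec c).
Proof.
have [p p0 p1] := ord_unif F_local.
have [s [_ _ _ sP]] := ord_residue F_local.
pose val := foldr (fun k y => s`_k + p * y) 0.
have pV : ord p^-1 = -1.
  apply/eqP; rewrite -(inj_eq (addrI (ord p))) -F_ordM ?invr_neq0// mulfV// ord1.
  by rewrite p1 subrr.
have valP n : forall y, ord_ge ord 0 y -> exists l, ord_ge ord n%:Z (y - val l).
  elim: n => [|n IHn] y y0; first by exists [::]; rewrite subr0.
  have [c [[cs yc] _]] := sP y y0.
  have [|l lP] := IHn (p^-1 * (y - c)).
    rewrite -[0](addNr 1) -{1}pV; apply: ord_geM yc; right; exact: lexx.
  exists (index c s :: l) => /=; rewrite nth_index// opprD addrA.
  have -> : y - c - p * val l = p * (p^-1 * (y - c) - val l).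
    by rewrite mulrBr mulVKf.
  rewrite intS -[X in X + _]p1; apply: ord_geM lP; right; exact: lexx.
exists (fun c => p ^- c.1 * val c.2) => x N.
pose M := `|ord x|%N.
have [|l lP] := valP (`|N| + M)%N (p ^+ M * x).
  have [->|x0] := eqVneq x 0; first by left; rewrite mulr0.
  by right; rewrite F_ordM ?expf_neq0// ordX// /M; lia.
exists (M, l) => /=.
have -> : x - p ^- M * val l = p ^- M * (p ^+ M * x - val l).
  by rewrite mulrBr mulKf// expf_neq0.
apply: (@ord_ge_le _ (- M%:Z + (`|N| + M)%N%:Z)); first by lia.
apply: ord_geM lP; right.
rewrite -(lerD2l (ord (p ^+ M))) -F_ordM ?invr_neq0 ?expf_neq0//.
by rewrite mulfV ?expf_neq0// ord1 ordX// subrr.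
Qed.

Lemma linear_forms_continuous (I J : finType) (a : J -> I -> F) (N : nat) :
  exists N' : nat, forall j c, (forall i, ord_ge ord N'%:Z (c i)) ->
    ord_ge ord N%:Z (\sum_i a j i * c i).
Proof.
pose B := (\sum_j \sum_i `|ord (a j i)|)%N.
exists (N + B)%N => j c cN; apply: ord_ge_sum => i.
apply: (@ord_ge_le _ (- B%:Z + (N + B)%N%:Z)); first by lia.
apply: ord_geM (cN i); right.
suff : (`|ord (a j i)| <= B)%N by lia.
rewrite /B (bigD1 j)//= (bigD1 i)//=; lia.
Qed.

End Separability.

(** * The Levi subgroup as a separable group *)

Section SpinGroups.
Variables (F : fieldType) (Cl : falgType F) (U : {vspace Cl}).

Lemma gspin1 : gspin U 1.
Proof.
split; [exact: (subvP (sub1_agenv _) _ (memv_line 1))|exact: unitr1|].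
by move=> y yU; rewrite mul1r invr1 mulr1.
Qed.

Lemma gspinM x y : gspin U x -> gspin U y -> gspin U (x * y).
Proof.
move=> [xA xu xU] [yA yu yU]; split; first exact: memvM.
  by rewrite unitrMr.
by move=> z zU; rewrite invrM// !mulrA -(mulrA x) -(mulrA x); apply/xU/yU.
Qed.

(** Conjugation by [x] is an injective endomorphism of the finite-dimensional
    space [U], hence onto. *)
Lemma gspinV x : gspin U x -> gspin U x^-1.
Proof.
move=> [xA xu xU]; split; rewrite ?memvV ?unitrV// invrK => y yU.
pose c : 'End(Cl) := (amulr (x^-1)%R \o amull x)%VF.
have cE z : c z = x * z * x^-1 by rewrite comp_lfunE lfunE /= lfunE.
have c0 : lker c == 0%VS.
  apply/lker0P => z1 z2; rewrite !cE => /(congr1 (fun z => x^-1 * (z * x))).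
  by rewrite !mulrVK// !mulKr.
have cU : (c @: U)%VS = U.
  apply/eqP; rewrite eqEdim limg_dim_eq ?(eqP c0) ?capv0// leqnn andbT.
  by apply/subvP => _ /memv_imgP[z zU ->]; rewrite cE; apply: xU.
move: yU; rewrite -{1}cU => /memv_imgP[z zU ->].
by rewrite cE mulrA mulrVK// mulKr.
Qed.

Lemma gspinZ c x : c != 0 -> gspin U x -> gspin U (c *: x).
Proof.
move=> c0 [xA xu xU]; split; first exact: memvZ.
  by rewrite scaler_unit ?unitfE.
move=> y yU; rewrite invrZ ?unitfE// -scalerAl -scalerAr -scalerAl scalerA.
by rewrite mulVf// scale1r; apply: xU.
Qed.

End SpinGroups.

Section LeviGroup.
Variables (F : fieldType) (ord : F -> int).
Variables (isB : bool) (r : nat) (ns : 'I_r -> nat) (m : nat).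
Variables (Cl : falgType F) (cl : {linear qspace F isB ns m -> Cl}).

Local Notation M := (levi_group ord cl).

Definition levi_inv (g : M) : M := ((fun i => invmx (g.1 i), g.2^-1) : M).

Lemma levi_group1 : lmem M (lone M).
Proof. by split=> [i|]; [exact: unitmx1|exact: gspin1]. Qed.

Lemma levi_groupM (g h : M) : lmem M g -> lmem M h -> lmem M (lmul g h).
Proof.
move=> [g1 g2] [h1 h2]; split=> [i|] /=; last exact: gspinM.
by rewrite unitmx_mul g1 h1.
Qed.

Lemma levi_groupV (g : M) : lmem M g -> lmem M (levi_inv g).
Proof.
by move=> [g1 g2]; split=> [i|] /=; [rewrite unitmx_inv|exact: gspinV].
Qed.

Lemma levi_mulKg (g h : M) : lmem M g -> lmul g (lmul (levi_inv g) h) = h.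
Proof.
move=> [g1 [_ g2 _]]; case: h => h1 h2; rewrite /lmul /=; congr pair.
  by apply: functional_extensionality_dep => i; rewrite mulKVmx.
by rewrite mulrA divrr// mul1r.
Qed.

Hypothesis F_local : exists q, nonarch_local_field ord q.

(** Left multiplication by the inverse of [g] is given by linear forms in the
    coordinates. *)
Lemma levi_mul_continuous (g : M) (N : nat) : exists N', forall h,
  lcong N' g h -> lmem M g -> lcong N (lmul (levi_inv g) h) (lone M).
Proof.
have [q F_loc] := F_local.
have /choice[N1 N1P] i : exists N1 : nat, forall (a : 'I_(ns i)) (c : 'I_(ns i) -> F),
    (forall b, ord_ge ord N1%:Z (c b)) ->
    ord_ge ord N%:Z (\sum_b - invmx (g.1 i) a b * c b).
  exact: (linear_forms_continuous F_loc).
have [N2 N2P] := linear_forms_continuous F_loc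
  (fun k (l : 'I_(\dim {:Cl}%VS)) => coord (vbasis {:Cl}%VS) k (- g.2^-1 * (vbasis {:Cl}%VS)`_l)) N.
exists (\sum_i N1 i + N2)%N => h [gh1 gh2] [g1 [_ g2 _]]; split=> [i a b|k] /=.
  have -> : (invmx (g.1 i) *m h.1 i) a b - 1%:M a b =
      \sum_c - invmx (g.1 i) a c * (g.1 i c b - h.1 i c b).
    have -> : 1%:M a b = (invmx (g.1 i) *m g.1 i) a b by rewrite mulVmx.
    rewrite !mxE -sumrB; apply: eq_bigr => c _.
    by rewrite mulNr mulrBr opprB.
  apply: N1P => c; apply: ord_ge_le (gh1 i c b).
  by rewrite lez_nat (bigD1 i)//= -!addnA leq_addr.
have -> : g.2^-1 * h.2 - 1 = - g.2^-1 * (g.2 - h.2).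
  by rewrite mulNr mulrBr mulVr// opprB.
rewrite [g.2 - h.2](coord_vbasis (memvf _)) mulr_sumr linear_sum /=.
under eq_bigr => l _ do rewrite -scalerAr linearZ /= mulrC.
apply: N2P => l; apply: ord_ge_le (gh2 l).
by rewrite lez_nat leq_addl.
Qed.

(** A subspace of a separable metric space is separable: in each ball around a
    point of a countable dense set of coordinates, pick an element of [M] if
    there is one. *)
Lemma levi_separable : exists d : nat -> M, forall g N, lmem M g ->
  exists n, lmem M (d n) /\ lcong N g (d n).
Proof.
have [q F_loc] := F_local; have [dec decP] := local_field_separable F_loc.
pose J : finType := ({i : 'I_r & 'I_(ns i) * 'I_(ns i)} + 'I_(\dim {:Cl}%VS))%type.
pose kappa (g : M) (j : J) : F := match j with
  | inl ab => g.1 (tag ab) (tagged ab).1 (tagged ab).2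
  | inr k => coord (vbasis {:Cl}%VS) k g.2 end.
have congP (N : nat) (g h : M) :
    lcong N g h <-> forall j, ord_ge ord N%:Z (kappa g j - kappa h j).
  split=> [[gh1 gh2] [[i [a b]]|k]|gh]; first exact: gh1.
    by have := gh2 k; rewrite linearB.
  split=> [i a b|k]; first exact: (gh (inl (Tagged _ (a, b)))).
  by rewrite /= linearB; apply: (gh (inr k)).
pose code := ({ffun J -> nat * seq nat} * nat)%type.
pose near (c : code) (g : M) := lmem M g /\
  forall j, ord_ge ord c.2%:Z (kappa g j - dec (c.1 j)).
have /choice[pt ptP] (c : code) : exists g, (exists h, near c h) -> near c g.
  have [[h hP]|nh] := pselect (exists h, near c h); first by exists h.
  by exists (lone M) => /nh.
exists (fun n => if unpickle n is Some c then pt c else lone M) => g N gM.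
have /choice[f fP] j : exists c, ord_ge ord N%:Z (kappa g j - dec c) by exact: decP.
pose c : code := ([ffun j => f j], N).
exists (pickle c); rewrite pickleK.
have [|ptM pt_near] := ptP c.
  by exists g; split=> // j; rewrite ffunE.
split=> //; apply/congP => j.
have -> : kappa g j - kappa (pt c) j =
    (kappa g j - dec (f j)) + (-1) * (kappa (pt c) j - dec (f j)).
  by rewrite mulN1r opprB addrA subrK.
apply: (ordD F_loc) => //; rewrite -[N%:Z]add0r; apply: (ord_geM F_loc).
  right; have : ord (-1 * -1) = 0 by rewrite mulrNN mulr1 (ord1 F_loc).
  by rewrite (ordM F_loc) ?oppr_eq0 ?oner_eq0//; lia.
by have := pt_near j; rewrite ffunE.
Qed.

Variables (R : realType) (V : lmodType R[i]) (sigma : M -> V -> V).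
Hypothesis sigma_rep : is_rep sigma.
Hypothesis sigma_smooth : smooth_rep sigma.
Hypothesis sigma_irr : irreducible_on (lmem M) sigma setT.

(** The orbit of a vector under a dense sequence of [M] is its whole [M]-orbit,
    because stabilizers are open. *)
Lemma levi_countable_dim : exists e : nat -> V, forall v,
  exists n (c : nat -> R[i]), v = \sum_(k < n) c k *: e k.
Proof.
have [lr r1 rM] := sigma_rep.
have [[v0 _ /eqP v00] _] := sigma_irr; have [N0 N0P] := sigma_smooth v0.
have [d dP] := levi_separable.
have orbit g : lmem M g -> exists n, lmem M (d n) /\ sigma (d n) v0 = sigma g v0.
  move=> gM; have [N' N'P] := levi_mul_continuous g N0.
  have [n [dM gd]] := dP g N' gM; exists n; split=> //.
  rewrite -(levi_mulKg (d n) gM) rM//; last exact/levi_groupM/dM/levi_groupV.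
  by rewrite N0P//; [exact/levi_groupM/dM/levi_groupV|exact: N'P].
pose e n := if `[< lmem M (d n) >] then sigma (d n) v0 else 0.
exists e.
pose U := [set v | exists n (c : nat -> R[i]), v = \sum_(k < n) c k *: e k].
have U0 : U 0 by exists 0%N, (fun=> 0); rewrite big_ord0.
have wide n n' (c : nat -> R[i]) : (n <= n')%N -> \sum_(k < n) c k *: e k =
    \sum_(k < n') (if (k < n)%N then c k else 0) *: e k.
  move=> nn'; rewrite (big_ord_widen _ (fun k => c k *: e k) nn') big_mkcond.
  by apply: eq_bigr => k _; case: ifP => // _; rewrite scale0r.
have Ul a u v : U u -> U v -> U (a *: u + v).
  move=> [n [c ->]] [n' [c' ->]]; exists (maxn n n').
  exists (fun k => a * (if (k < n)%N then c k else 0) + if (k < n')%N then c' k else 0).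
  rewrite (wide n (maxn n n')) ?leq_maxl// (wide n' (maxn n n')) ?leq_maxr//.
  rewrite scaler_sumr -big_split; apply: eq_bigr => k _.
  by rewrite scalerDl scalerA.
have Ue n : U (e n).
  exists n.+1, (fun k => (k == n)%:R); rewrite big_ord_recr /= eqxx scale1r.
  by rewrite big1 ?add0r// => k _; rewrite ltn_eqF// scale0r.
apply: (simple_eqT sigma_irr U0 Ul).
  move=> g _ gM [n [c ->]]; rewrite (lin_sum (lr _ gM)).
  elim/big_rec: _ => // k x _ Ux; rewrite (linZ (lr _ gM)); apply: Ul => //.
  rewrite /e; case: asboolP => [dM|_]; last by rewrite (lin0 (lr _ gM)).
  rewrite -rM//; have [k' [dM' <-]] := orbit _ (levi_groupM gM dM).
  by have := Ue k'; rewrite /e asboolT.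
exists v0; split=> //.
have [n [dM e0]] := orbit _ levi_group1.
by have := Ue n; rewrite /e asboolT// e0 r1.
Qed.

Lemma levi_schur (A : V -> V) : linear A ->
  (forall g v, lmem M g -> A (sigma g v) = sigma g (A v)) ->
  exists a, forall v, A v = a *: v.
Proof.
have [e eP] := levi_countable_dim; have [lr _ _] := sigma_rep.
exact: (schur_countable_dim (@complex_uncountable R) sigma_irr lr eP).
Qed.

End LeviGroup.

(** * The outer automorphism in type D *)

Section Outer.
Variables (F : fieldType) (Cl : falgType F).

(** Conjugation by [v] preserves [U], hence the algebra generated by [U * U]. *)
Lemma gspin_conj (U : {vspace Cl}) (v : Cl) : v \is a GRing.unit ->
  (forall y, y \in U -> v * y * v^-1 \in U) ->
  (forall y, y \in U -> v^-1 * y * v \in U) ->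
  forall h, gspin U h -> gspin U (v * h * v^-1).
Proof.
move=> vu vU vU' h [hA hu hU]; split.
- pose c : 'End(Cl) := (amulr v \o amull (v^-1)%R)%VF.
  have cE z : c z = v^-1 * z * v by rewrite comp_lfunE lfunE /= lfunE.
  have : (agenv (U * U) <= c @: agenv (U * U))%VS.
    apply: agenv_sub_modl.
      apply/subvP => _ /vlineP[a ->]; apply: memvZ.
      have -> : 1 = c 1 by rewrite cE mulr1 mulVr.
      exact/memv_img/(subvP (sub1_agenv _))/memv_line.
    have UU : (U * U <= c @: (U * U))%VS.
      apply/prodvP => x z xU zU.
      have -> : x * z = c ((v * x * v^-1) * (v * z * v^-1)).
        by rewrite cE !mulrA mulVr// mul1r !mulrVK.
      by apply/memv_img/memv_mul; apply: vU.
    apply/prodvP => x z /(subvP UU)/memv_imgP[b bUU ->] /memv_imgP[a aA ->].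
    have -> : c b * c a = c (b * a) by rewrite !cE !mulrA mulrK.
    exact/memv_img/memvM/aA/(subvP (sub_agenv _)).
  move=> /subvP/(_ h hA)/memv_imgP[z zA ->].
  by rewrite cE !mulrA divrr// mul1r mulrK.
- by rewrite unitrMl ?unitrMr// unitrV.
- move=> y yU; rewrite !invrM ?unitrV ?unitrMr// invrK.
  have -> : v * h / v * y * (v * (h^-1 / v)) = v * (h * (v^-1 * y * v) / h) / v.
    by rewrite !mulrA.
  exact/vU/hU/vU'.
Qed.

End Outer.

Section OuterGm.
Variables (F : fieldType) (isB : bool) (r : nat) (ns : 'I_r -> nat) (m : nat).
Variables (Cl : falgType F) (cl : {linear qspace F isB ns m -> Cl}).
Hypothesis cl_sq : forall v, cl v * cl v = split_form v *: 1.

(** Polarization of the defining relation. *)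
Lemma clifford_anticomm v w : exists b, cl v * cl w + cl w * cl v = b *: 1.
Proof.
exists (split_form (v + w) - split_form v - split_form w).
rewrite !scalerBl -!cl_sq linearD mulrDl !mulrDr.
by apply/esym/eqP; rewrite !subr_eq -!addrA addrC -!addrA.
Qed.

Let b0 (k : 'I_m) (s : bool) : basis_index isB ns m := inl (inr k, s).

Lemma gen_core k s : gen cl (b0 k s) \in Vcore cl.
Proof.
by rewrite /Vcore (bigD1 (b0 k s))//=; apply/(subvP (addvSl _ _))/memv_line.
Qed.

Lemma core_cl y : y \in Vcore cl -> exists v, y = cl v.
Proof.
move=> /memv_sumP[z zP ->].
have /choice[f fP] b : exists v, level b == r -> z b = cl v.
  have [lb|] := boolP (level b == r); last by exists 0.
  by have /vlineP[a ->] := zP b lb; eexists => _; rewrite -linearZ.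
exists (\sum_(b | level b == r) f b); rewrite linear_sum.
by apply: eq_bigr => b /fP.
Qed.

(** The quadratic form takes the value [-1] at [e - f]. *)
Lemma reflection_sq k : let v := gen cl (b0 k false) - gen cl (b0 k true) in
  v * v = -1.
Proof.
rewrite /gen -linearB /= cl_sq; set w := _ - _.
suff -> : split_form w = -1 by rewrite scaleN1r.
rewrite /split_form (bigD1 (inr k))//= big1 ?big1.
- have eb s s' : (inl (inr k, s) == b0 k s') = (s == s').
    by apply/eqP/eqP => [[]|->].
  by rewrite !addr0 !ffunE !eb /= subr0 sub0r mul1r.
- by move=> j _; rewrite !ffunE /= subr0 expr0n.
- move=> i ik; rewrite [w (inl (i, false))]ffunE.
  have ni s s' : (inl (i, s) == b0 k s') = false.
    by apply/eqP => -[ie _]; rewrite ie eqxx in ik.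
  by rewrite !ffunE !ni subrr mul0r.
Qed.

Lemma outerP : (forall h, outer cl h = h) \/
  exists v, [/\ v \in Vcore cl, v * v = -1 & forall h, outer cl h = v * h * v^-1].
Proof.
rewrite /outer; case: pickP => [k _|_]; last by left.
right; exists (gen cl (b0 k false) - gen cl (b0 k true)); split=> //.
  by rewrite rpredB// gen_core.
exact: reflection_sq.
Qed.

Lemma sq_opp1_unit (v : Cl) : v * v = -1 -> v \is a GRing.unit /\ v^-1 = - v.
Proof.
move=> vv; have vu : v \is a GRing.unit.
  by apply/unitrP; exists (- v); rewrite mulNr mulrN vv opprK.
by split=> //; apply: (mulrI vu); rewrite mulrN vv opprK divrr.
Qed.

Lemma outer1 : outer cl 1 = 1.
Proof.
have [->//|[v [_ vv ->]]] := outerP; have [vu _] := sq_opp1_unit vv.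
by rewrite mulr1 divrr.
Qed.

Lemma outerK h : outer cl (outer cl h) = h.
Proof.
have [e|[v [_ vv e]]] := outerP; rewrite !e//; have [vu vV] := sq_opp1_unit vv.
by rewrite !mulrA vv -mulrA vV mulrNN vv mulN1r mulrN1 opprK.
Qed.

(** Conjugation by a vector [v] of square [-1] is, up to sign, an orthogonal
    reflection, so it preserves the quadratic space containing [v]. *)
Lemma outer_Gm h : Gm cl h -> Gm cl (outer cl h).
Proof.
move=> hG; have [->//|[v [vV vv ->]]] := outerP; have [vu vi] := sq_opp1_unit vv.
have refl y : y \in Vcore cl -> v * y * v \in Vcore cl.
  move=> yV; have [v' v'E] := core_cl vV; have [y' y'E] := core_cl yV.
  have [b bE] := clifford_anticomm v' y'; rewrite -v'E -y'E in bE.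
  have -> : v * y * v = b *: v + y.
    rewrite (_ : v * y = b *: 1 - y * v); last by rewrite -bE addrK.
    by rewrite mulrBl -mulrA vv mulrN1 opprK -scalerAl mul1r.
  by rewrite rpredD// rpredZ.
apply: gspin_conj => // y yV; rewrite vi ?mulrN ?mulNr rpredN; exact: refl.
Qed.

End OuterGm.

(** * The action of signed permutations on the Levi subgroup *)

Section ConformMatrices.
Variables (F : fieldType).

Definition contragredient (e : bool) n (g : 'M[F]_n) : 'M[F]_n :=
  if e then (invmx g)^T else g.

Lemma contragredientK e n : involutive (@contragredient e n).
Proof. by case: e => // g; rewrite /contragredient trmx_inv trmxK invmxK. Qed.

Lemma contragredient_comp e d n (g : 'M[F]_n) :
  contragredient e (contragredient d g) = contragredient (e (+) d) g.
Proof. by case: e; case: d => //; apply: contragredientK. Qed.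

Lemma contragredient1 e n : contragredient e (1%:M : 'M[F]_n) = 1%:M.
Proof. by case: e; rewrite // /contragredient invmx1 trmx1. Qed.

Lemma contragredient_unitmx e n (g : 'M[F]_n) :
  (contragredient e g \in unitmx) = (g \in unitmx).
Proof. by case: e; rewrite // /contragredient unitmx_tr unitmx_inv. Qed.

Lemma conform_unitmx n n1 (B : 'M[F]_n1) (g : 'M[F]_n) : n1 = n ->
  (conform_mx B g \in unitmx) = (g \in unitmx).
Proof. by move=> e; subst n1; rewrite conform_mx_id. Qed.

Lemma conform_contragredient e n n1 (g : 'M[F]_n) : n1 = n ->
  conform_mx (1%:M : 'M[F]_n1) (contragredient e g) =
  contragredient e (conform_mx (1%:M : 'M[F]_n1) g).
Proof. by move=> en; subst n1; rewrite !conform_mx_id. Qed.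

Lemma conform_det n n1 (B : 'M[F]_n1) (g : 'M[F]_n) : n1 = n ->
  \det (conform_mx B g) = \det g.
Proof. by move=> e; subst n1; rewrite conform_mx_id. Qed.

Lemma conform_comp n n1 n2 (B : 'M[F]_n2) (B' : 'M[F]_n1) (g : 'M[F]_n) :
  n2 = n1 -> n1 = n -> conform_mx B (conform_mx B' g) = conform_mx B g.
Proof. by move=> e e'; subst n2 n1; rewrite !conform_mx_id. Qed.

Lemma conform1 n n1 : n1 = n -> conform_mx (1%:M : 'M[F]_n1) (1%:M : 'M[F]_n) = 1%:M.
Proof. by move=> e; subst n1; rewrite conform_mx_id. Qed.

End ConformMatrices.

Lemma dfwith_app (I : eqType) (A B : I -> Type) (f : forall i, A i -> B i)
    (x : forall i, A i) i (u : A i) :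
  (fun j => f j (eqtype.dfwith x u j)) =
  eqtype.dfwith (fun j => f j (x j)) (f i u).
Proof.
apply: functional_extensionality_dep => j; have [<-|ij] := eqVneq i j.
  by rewrite !eqtype.dfwith_in.
by rewrite !eqtype.dfwith_out.
Qed.

Section WeylAction.
Variables (F : fieldType) (ord : F -> int).
Variables (isB : bool) (r : nat) (ns : 'I_r -> nat) (m : nat).
Variables (Cl : falgType F) (cl : {linear qspace F isB ns m -> Cl}).

Local Notation M := (levi_group ord cl).

Definition outer_pow (e : bool) (h : Cl) : Cl := if e then outer cl h else h.

(** Whether [w] acts on [G_m] through its outer automorphism. *)
Definition weyl_outer (w : sperm r) : bool :=
  ~~ isB && odd (\sum_(j | w.2 j) ns j).

(** In [w sigma] the factor [j] sees the block [w j]. *)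
Lemma weyl_act_sinv (w : sperm r) (g : M) : (forall i, ns (w.1 i) = ns i) ->
  weyl_act (sinv w) g =
  ((fun j => conform_mx 1%:M (contragredient (w.2 j) (g.1 (w.1 j))),
    (\prod_(j | w.2 j) \det (g.1 (w.1 j))) *: outer_pow (weyl_outer w) g.2) : M).
Proof.
move=> nsw; rewrite /weyl_act /sinv /=; congr pair.
  apply: functional_extensionality_dep => j.
  by rewrite !invgK ffunE permK.
have reind (R : Type) (idx : R) (op : Monoid.com_law idx) (f : 'I_r -> R) :
    \big[op/idx]_(i | [ffun j => w.2 ((w.1^-1)%g j)] i) f i =
    \big[op/idx]_(j | w.2 j) f (w.1 j).
  rewrite (reindex_inj (@perm_inj _ w.1)); apply: eq_bigl => j.
  by rewrite ffunE permK.
rewrite !reind /weyl_outer.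
by have -> : (\sum_(j | w.2 j) ns (w.1 j) = \sum_(j | w.2 j) ns j)%N by exact: eq_bigr.
Qed.

Lemma weyl_outer_mul (w1 w2 : sperm r) : (forall i, ns (w2.1 i) = ns i) ->
  weyl_outer (smul w1 w2) = weyl_outer w1 (+) weyl_outer w2.
Proof.
move=> nsw; rewrite /weyl_outer; case: isB => //=.
have sumE (f : 'I_r -> bool) :
    odd (\sum_(j | f j) ns j) = \big[addb/false]_j (f j && odd (ns j)).
  rewrite big_mkcond (big_morph odd oddD (erefl _)).
  by apply: eq_bigr => j _; case: (f j).
rewrite !sumE [X in _ = X (+) _](reindex_inj (@perm_inj _ w2.1)) -big_split.
apply: eq_bigr => j _; rewrite ffunE nsw /=.
by case: (w2.2 j); case: (w1.2 _); case: (odd _).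
Qed.

End WeylAction.

(** * The factors of the representation *)

Section IntertwiningOperators.
Variables (R : realType) (F : fieldType) (ord : F -> int) (q : nat).
Hypothesis F_local : nonarch_local_field ord q.
Variables (isB : bool) (r : nat) (ns : 'I_r -> nat) (m : nat).
Variables (Cl : falgType F) (cl : {linear qspace F isB ns m -> Cl}).
Hypothesis cl_clifford : is_clifford cl.

Local Notation M := (levi_group ord cl).
Local Notation C := (R[i]).

Variables (Vs : 'I_r -> lmodType C) (Vt V : lmodType C).
Variable sigmas : forall i, GL_group ord (ns i) -> Vs i -> Vs i.
Variables (tau : Gm_group ord cl -> Vt -> Vt) (sigma : M -> V -> V).
Hypothesis sigmas_rep : forall i, is_rep (@sigmas i).
Hypothesis tau_rep : is_rep tau.
Variable t : (forall i, Vs i) -> Vt -> V.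
Hypothesis t_tensor : is_tensor t.
Hypothesis sigma_tensor : forall g, lmem M g -> forall x y,
  sigma g (t x y) = t (fun i => @sigmas i (g.1 i) (x i)) (tau g.2 y).
Hypothesis sigma_ds : irreducible_discrete_series sigma.

Let sigma_rep : is_rep sigma. Proof. by case: sigma_ds. Qed.
Let sigma_irr : irreducible_on (lmem M) sigma setT. Proof. by case: sigma_ds. Qed.

Let sigma_schur (A : V -> V) : linear A ->
  (forall g v, lmem M g -> A (sigma g v) = sigma g (A v)) ->
  exists a, forall v, A v = a *: v.
Proof.
apply: levi_schur => //; first by exists q.
by case: sigma_ds.
Qed.

Let V_neq0 : exists v : V, v != 0.
Proof. by have [[v _ v0] _] := sigma_irr; exists v. Qed.

Let cl_sq : forall v, cl v * cl v = split_form v *: 1.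
Proof. exact: (proj1 cl_clifford). Qed.

Let sigmas1 i v : @sigmas i (1%:M) v = v.
Proof. by have [_ e _] := sigmas_rep i; apply: e. Qed.

Let sigmas_lin i (g : 'M[F]_(ns i)) : g \in unitmx -> linear (@sigmas i g).
Proof. by have [e _ _] := sigmas_rep i; apply: e. Qed.

Let tau1 v : tau 1 v = v.
Proof. by have [_ e _] := tau_rep; apply: e. Qed.

Let sigma_lin (g : M) : lmem M g -> linear (sigma g).
Proof. by have [e _ _] := sigma_rep; apply: e. Qed.

Let iota i (p : (forall j, Vs j) * Vt) (u : Vs i) : V := t (eqtype.dfwith p.1 u) p.2.

Let sigma_iota i (g : M) : lmem M g -> exists2 h, [set h | h \in unitmx] h &
  forall p, exists p', forall u, sigma g (@iota i p u) = iota p' (@sigmas i h u).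
Proof.
move=> gM; exists (g.1 i); first by have [g1 _] := gM; apply: g1.
move=> p; exists (fun j => @sigmas j (g.1 j) (p.1 j), tau g.2 p.2) => u.
by rewrite /iota sigma_tensor// (dfwith_app (fun j => @sigmas j (g.1 j))).
Qed.

Let sigma_last (g : M) : lmem M g -> exists2 h, Gm cl h &
  forall x, exists x', forall u, sigma g (t x u) = t x' (tau h u).
Proof.
move=> gM; exists g.2; first by case: gM.
by move=> x; exists (fun j => @sigmas j (g.1 j) (x j)) => u; rewrite sigma_tensor.
Qed.

Lemma sigmas_simple i : irreducible_on [set g | g \in unitmx] (@sigmas i) setT.
Proof.
exact: (factor_simple (tensor_factor t_tensor V_neq0 i) sigma_lin (@sigma_iota i) sigma_irr).
Qed.

Lemma tau_simple : irreducible_on (Gm cl) tau setT.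
Proof.
exact: (factor_simple (tensor_last_factor t_tensor V_neq0) sigma_lin sigma_last sigma_irr).
Qed.

Lemma sigmas_schur i (E : Vs i -> Vs i) : linear E ->
  (forall h u, h \in unitmx -> E (@sigmas i h u) = @sigmas i h (E u)) ->
  exists a, forall u, E u = a *: u.
Proof.
exact: (factor_schur (tensor_factor t_tensor V_neq0 i) sigma_lin (@sigma_iota i) sigma_schur).
Qed.

Lemma tau_schur (E : Vt -> Vt) : linear E ->
  (forall h u, Gm cl h -> E (tau h u) = tau h (E u)) ->
  exists a, forall u, E u = a *: u.
Proof.
exact: (factor_schur (tensor_last_factor t_tensor V_neq0) sigma_lin sigma_last sigma_schur).
Qed.

(** * The central character on scalars *)

Let scal (c : F) : M := (fun i => 1%:M, c *: 1).

Let scal_mem c : c != 0 -> lmem M (scal c).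
Proof.
by move=> c0; split=> [i|]; [exact: unitmx1|exact: (gspinZ c0 (gspin1 _))].
Qed.

(** The scalars [e_0^*(c)] are central in [M]. *)
Lemma scalar_character : exists chi : F -> C,
  (forall c, c != 0 -> chi c != 0) /\
  (forall c v, c != 0 -> sigma (scal c) v = chi c *: v).
Proof.
have /choice[chi chiP] c : exists z : C, c != 0 -> z != 0 /\
    forall v, sigma (scal c) v = z *: v.
  have [->|c0] := eqVneq c 0; first by exists 0.
  have [_ _ _ /(_ (scal c)) cen _] := sigma_ds.
  have [|z [z1 zP]] := cen.
    split=> [|g gM]; first exact: scal_mem.
    rewrite /lmul /=; congr pair.
      by apply: functional_extensionality_dep => i; rewrite mul1mx mulmx1.
    by rewrite -scalerAl -scalerAr mul1r mulr1.
  by exists z => _; split=> //; rewrite -normr_eq0 z1 oner_neq0.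
by exists chi; split=> [c c0|c v c0]; have [] := chiP c c0.
Qed.

(** * Isomorphisms between the factors and their duals *)

Section ScalarCharacter.
Variable chi : F -> C.
Hypothesis chi_neq0 : forall c, c != 0 -> chi c != 0.
Hypothesis chiE : forall c v, c != 0 -> sigma (scal c) v = chi c *: v.

Lemma chiM a b : a != 0 -> b != 0 -> chi (a * b) = chi a * chi b.
Proof.
move=> a0 b0; have [v v0] := V_neq0; have [_ _ sM] := sigma_rep.
apply/eqP; rewrite -subr_eq0; apply/negPn/negP => /negPf ab.
have : (chi (a * b) - chi a * chi b) *: v = 0.
  rewrite scalerBl -scalerA -!chiE ?mulf_neq0// -sM; do ?exact: scal_mem.
  rewrite (_ : lmul _ _ = scal (a * b)) ?subrr//.
  rewrite /lmul /=; congr pair; last by rewrite -scalerAl mul1r scalerA.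
  by apply: functional_extensionality_dep => i; rewrite mul1mx.
by move/eqP; rewrite scaler_eq0 ab (negPf v0).
Qed.

Lemma chi1 : chi 1 = 1.
Proof.
by apply: (mulfI (chi_neq0 (oner_neq0 F))); rewrite -chiM ?oner_neq0// !mulr1.
Qed.

Lemma chi_prod (I : Type) (s : seq I) (P : pred I) (f : I -> F) :
  (forall i, f i != 0) ->
  chi (\prod_(i <- s | P i) f i) = \prod_(i <- s | P i) chi (f i).
Proof.
move=> f0; have : chi (\prod_(i <- s | P i) f i) = \prod_(i <- s | P i) chi (f i) /\
    \prod_(i <- s | P i) f i != 0.
  apply: (big_ind2 (fun x y => chi x = y /\ x != 0)).
  - by rewrite chi1 oner_neq0.
  - by move=> x _ y _ [<- x0] [<- y0]; rewrite chiM// mulf_neq0.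
  - by move=> i _; rewrite f0.
by case.
Qed.

Definition chi_pow (e : bool) (c : F) : C := if e then chi c else 1.

Lemma chi_pow_neq0 e c : c != 0 -> chi_pow e c != 0.
Proof. by case: e => [/chi_neq0|_] //; apply: oner_neq0. Qed.

Lemma det_neq0 n (g : 'M[F]_n) : g \in unitmx -> \det g != 0.
Proof. by rewrite unitmxE unitfE. Qed.

Lemma det_contragredient e n (g : 'M[F]_n) : g \in unitmx ->
  chi_pow e (\det g) * chi_pow e (\det (contragredient e g)) = 1.
Proof.
move=> gu; case: e; rewrite /= ?mulr1//.
rewrite /contragredient det_tr -chiM ?det_neq0 ?unitmx_inv//.
by rewrite -det_mulmx mulmxV// det1 chi1.
Qed.

(** [GL_(n_k)] acting on [V_i], directly or through the sign change: the
    twist by the determinant is the contribution of [e_0^*(det g)]. *)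
Definition sigmas_dual i k (e : bool) (g : 'M[F]_(ns k)) (v : Vs i) : Vs i :=
  chi_pow e (\det g) *: @sigmas i (conform_mx 1%:M (contragredient e g)) v.

Lemma sigmas_dual1 i k e v : ns i = ns k -> sigmas_dual (i := i) (k := k) e 1%:M v = v.
Proof.
move=> nik; rewrite /sigmas_dual contragredient1 conform1// sigmas1 det1.
by case: e; rewrite /= ?chi1 scale1r.
Qed.

Lemma sigmas_dual_simple i k e : ns i = ns k ->
  irreducible_on [set g | g \in unitmx] (@sigmas_dual i k e) setT.
Proof.
move=> nik; have [ne irr] := sigmas_simple i; split=> // U UT U0 Ul Ug.
apply: irr => // g u gu Uu.
have gu' : contragredient e (conform_mx (1%:M : 'M[F]_(ns k)) g) \in unitmx.
  by rewrite contragredient_unitmx conform_unitmx.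
have := Ug _ u gu' Uu.
rewrite /sigmas_dual contragredientK conform_comp// conform_mx_id.
set c := chi_pow _ _ => Uc.
have c0 : c != 0 by apply/chi_pow_neq0/det_neq0.
by have := Ul c^-1 _ _ Uc U0; rewrite addr0 scalerK.
Qed.

(** The case [e = true] is an isomorphism from the twisted dual of [sigma_i]; the
    equality of sizes makes the casts in [sigmas_dual] meaningful. *)
Definition sigmas_iso i j (e : bool) (A : Vs i -> Vs j) : Prop :=
  [/\ ns i = ns j, linear A, bijective A &
  forall (g : 'M[F]_(ns j)) v, g \in unitmx ->
    A (sigmas_dual e g v) = @sigmas j g (A v)].

(** Two dualizations cancel, and so do the two twists, by
    [det_contragredient]. *)
Lemma sigmas_iso_comp i j k e d (A : Vs i -> Vs j) (B : Vs j -> Vs k) :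
  sigmas_iso e A -> sigmas_iso d B -> sigmas_iso (e (+) d) (B \o A).
Proof.
move=> [nij lA bA eA] [njk lB bB eB]; split.
- by rewrite nij.
- exact: lin_comp.
- exact: bij_comp.
- move=> g v gu /=.
  rewrite -eB// /sigmas_dual -eA; last first.
    by rewrite conform_unitmx// contragredient_unitmx.
  rewrite /sigmas_dual -(linZ lA); congr (B (A _)); rewrite scalerA.
  rewrite -conform_contragredient// conform_comp// contragredient_comp.
  congr (_ *: _); rewrite conform_det//; case: e {eA}; case: d {eB} => //=.
  + by rewrite -[LHS](det_contragredient true gu).
  + by rewrite mul1r.
  + by rewrite mulr1.
  + by rewrite mulr1.
Qed.

Lemma sigmas_coherent : exists A : forall i j, bool -> Vs i -> Vs j,
    (forall i j e, (exists B, @sigmas_iso i j e B) -> sigmas_iso e (A i j e)) /\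
    (forall i j k e d v, (exists B, @sigmas_iso i j e B) ->
       (exists B, @sigmas_iso j k d B) -> A j k d (A i j e v) = A i k (e (+) d) v).
Proof.
apply: coherent_isos.
- by move=> i j e A [].
- by move=> i j e A [].
- move=> i; split=> //; first by exists id.
  by move=> g v gu; rewrite /sigmas_dual /= conform_mx_id scale1r.
- exact: sigmas_iso_comp.
- move=> i j e A B [nij lA bA eA] AK BK; split=> //.
  + exact: lin_can AK BK.
  + by exists A.
  + move=> g v gu; rewrite -[v in LHS]BK; move: (B v) => u.
    rewrite /sigmas_dual -eA; last first.
      by rewrite conform_unitmx// contragredient_unitmx.
    rewrite -(linZ lA) AK /sigmas_dual -conform_contragredient// contragredientK.
    by rewrite conform_comp// conform_mx_id conform_det// scalerA det_contragredient// scale1r.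
- move=> i j e a A a0 [nij lA bA eA]; split=> //.
  + exact: lin_scale.
  + exact: scale_bijective.
  + by move=> g v gu; rewrite eA// (linZ (sigmas_lin gu)).
- move=> i A [_ lA _ eA]; apply: sigmas_schur => // g u gu.
  by rewrite -eA// /sigmas_dual /= conform_mx_id scale1r.
Qed.

Lemma outer_pow_Gm e h : Gm cl h -> Gm cl (outer_pow cl e h).
Proof. by case: e => //; exact: (outer_Gm cl_sq). Qed.

Lemma outer_pow_comp e d h :
  outer_pow cl e (outer_pow cl d h) = outer_pow cl (e (+) d) h.
Proof. by case: e; case: d => //; exact: (outerK cl_sq). Qed.

Definition tau_iso (e : bool) (A : Vt -> Vt) : Prop :=
  [/\ linear A, bijective A &
  forall h v, Gm cl h -> A (tau (outer_pow cl e h) v) = tau h (A v)].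

Lemma tau_iso_comp e d (A B : Vt -> Vt) :
  tau_iso e A -> tau_iso d B -> tau_iso (e (+) d) (B \o A).
Proof.
move=> [lA bA eA] [lB bB eB]; split.
- exact: lin_comp.
- exact: bij_comp.
- by move=> h v hG /=; rewrite -outer_pow_comp eA ?eB//; exact: outer_pow_Gm.
Qed.

(** The family of representations is here reduced to [tau], with the outer
    automorphism in the role of the duality. *)
Lemma tau_coherent : exists A : bool -> Vt -> Vt,
    (forall e, (exists B, tau_iso e B) -> tau_iso e (A e)) /\
    (forall e d v, (exists B, tau_iso e B) -> (exists B, tau_iso d B) ->
       A d (A e v) = A (e (+) d) v).
Proof.
have [lt _ _] := tau_rep.
suff [A [AP AM]] : exists A : forall i j : unit, bool -> Vt -> Vt,
    (forall i j e, (exists B, tau_iso e B) -> tau_iso e (A i j e)) /\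
    (forall i j k e d v, (exists B, tau_iso e B) -> (exists B, tau_iso d B) ->
       A j k d (A i j e v) = A i k (e (+) d) v).
  by exists (A tt tt); split=> [e|e d v]; [exact: AP|exact: AM].
apply: (@coherent_isos C unit (fun=> Vt) (fun _ _ => tau_iso)).
- by move=> _ _ e A [].
- by move=> _ _ e A [].
- by move=> _; split=> //; exists id.
- by move=> _ _ _ e d A B; exact: tau_iso_comp.
- move=> _ _ e A B [lA bA eA] AK BK; split.
  + exact: lin_can AK BK.
  + by exists A.
  + move=> h v hG; rewrite -[v in LHS]BK; move: (B v) => u.
    by rewrite -eA ?outer_pow_comp ?addbb ?AK//; exact: outer_pow_Gm.
- move=> _ _ e a A a0 [lA bA eA]; split.
  + exact: lin_scale.
  + exact: scale_bijective.
  + by move=> h v hG; rewrite eA// (linZ (lt _ hG)).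
- by move=> _ A [lA _ eA]; apply: tau_schur => // h u hG; rewrite -eA.
Qed.

(** * The operators *)

(** The scalar [e_0^*(det g_i)] that a sign change moves to [G_m] acts through
    [chi], and is redistributed here to the factors. *)
Lemma twist_tensor (w : sperm r) (g : M) x y :
  (forall i, ns (w.1 i) = ns i) -> lmem M g ->
  twist sigma w g (t x y) =
  t (fun j => sigmas_dual (w.2 j) (g.1 (w.1 j)) (x j))
    (tau (outer_pow cl (weyl_outer isB ns w) g.2) y).
Proof.
move=> nsw gM; have [g1 g2] := gM; have [_ _ sM] := sigma_rep.
rewrite /twist weyl_act_sinv//.
set c := \prod_(j | _) _; set h := outer_pow _ _ _.
have c0 : c != 0 by apply/prodf_neq0 => j _; apply/det_neq0.
have hG : Gm cl h by exact: outer_pow_Gm.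
pose g' : M := (fun j => conform_mx 1%:M (contragredient (w.2 j) (g.1 (w.1 j))), h).
have g'M : lmem M g'.
  by split=> [j|] //=; rewrite conform_unitmx// contragredient_unitmx.
rewrite (_ : (_, _) = lmul (scal c) g'); last first.
  rewrite /lmul /=; congr pair; last by rewrite -scalerAl mul1r.
  by apply: functional_extensionality_dep => j; rewrite mul1mx.
rewrite sM//; last exact: scal_mem.
rewrite chiE// sigma_tensor// (tensor_scale t_tensor); congr (_ *: _).
rewrite /c chi_prod; last by move=> j; apply/det_neq0.
by rewrite big_mkcond.
Qed.

(** An isomorphism of [w sigma] with [sigma] forces isomorphisms of the factors:
    restrict it to a factor [V_j] of [V], on which a single factor of [M] acts
    through the [w j]-th one. *)
Lemma sigmas_iso_exists (w : sperm r) j : (forall i, ns (w.1 i) = ns i) ->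
  rep_iso (twist sigma w) sigma -> exists A, @sigmas_iso j (w.1 j) (w.2 j) A.
Proof.
move=> nsw [Phi [bPhi ePhi]]; set k := w.1 j; set e := w.2 j.
have njk : ns j = ns k by rewrite nsw.
have [x [y [txy _ _]]] := tensor_nonzero_factors t_tensor V_neq0.
have [lj _ _ _] := tensor_factor t_tensor V_neq0 j.
have [lk gen _ _] := tensor_factor t_tensor V_neq0 k.
pose inj_k (g : 'M[F]_(ns k)) : M := (eqtype.dfwith (fun i => 1%:M) g, 1).
have inj_M (g : 'M[F]_(ns k)) : g \in unitmx -> lmem M (inj_k g).
  move=> gu; split=> [i|] /=; last exact: gspin1.
  by case: eqtype.dfwithP => // i' _; exact: unitmx1.
have eqJ (g : 'M[F]_(ns k)) z : g \in unitmx ->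
    Phi (iota (x, y) (sigmas_dual e g z)) = sigma (inj_k g) (Phi (@iota j (x, y) z)).
  move=> gu; rewrite -ePhi; last exact: inj_M.
  rewrite /iota /= twist_tensor//; last exact: inj_M.
  have -> : outer_pow cl (weyl_outer isB ns w) 1 = 1.
    by case: (weyl_outer _ _ _) => //; exact: (outer1 cl_sq).
  rewrite tau1 /inj_k /=; congr (Phi (t _ y)).
  apply: functional_extensionality_dep => i; have [<-|ij] := eqVneq j i.
    by rewrite !eqtype.dfwith_in.
  have ki : k != w.1 i by rewrite (inj_eq perm_inj).
  by rewrite !eqtype.dfwith_out// sigmas_dual1// nsw.
have [A [lA bA eA]] : exists A : Vs j -> Vs k, [/\ linear A, bijective A &
    forall g z, g \in unitmx -> A (sigmas_dual e g z) = @sigmas k g (A z)].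
  apply: (simple_sub_isotypic (sigmas_dual_simple e njk) (sigmas_simple k)
    (rhoV := fun g => sigma (inj_k g)) _ _ lk _ (J := Phi \o @iota j (x, y))) => //.
  - by move=> g gu; apply/sigma_lin/inj_M.
  - by move=> g gu; apply: sigmas_lin.
  - move=> p g u gu; rewrite /iota sigma_tensor/=; last exact: inj_M.
    rewrite tau1; congr (t _ _); apply: functional_extensionality_dep => i.
    have [<-|ki] := eqVneq k i; first by rewrite !eqtype.dfwith_in.
    by rewrite !eqtype.dfwith_out// sigmas1.
  - by apply: lin_comp; [move=> a u v; rewrite linearP|exact: lj].
  - exists (x j) => /= e0; apply: txy; apply: (bij_inj bPhi).
    by rewrite linear0 -e0 /iota /= dfwith_id.
by exists A; split.
Qed.

(** The same argument on the factor [V_t], through which [G_m] acts. *)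
Lemma tau_iso_exists (w : sperm r) : (forall i, ns (w.1 i) = ns i) ->
  rep_iso (twist sigma w) sigma -> exists A, tau_iso (weyl_outer isB ns w) A.
Proof.
move=> nsw [Phi [bPhi ePhi]]; set e := weyl_outer isB ns w.
have [x [y [txy _ _]]] := tensor_nonzero_factors t_tensor V_neq0.
have [l0 gen _ _] := tensor_last_factor t_tensor V_neq0.
have [lt _ _] := tau_rep.
pose inj0 (h : Cl) : M := (fun i => 1%:M, h).
have inj0_M h : Gm cl h -> lmem M (inj0 h).
  by move=> hG; split=> [i|] //=; exact: unitmx1.
have twist_simple : irreducible_on (Gm cl) (fun h => tau (outer_pow cl e h)) setT.
  have [ne irr] := tau_simple; split=> // U UT U0 Ul Ug.
  apply: irr => // h u hG Uu.
  by have := Ug _ u (outer_pow_Gm e hG) Uu; rewrite outer_pow_comp addbb.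
have [A [lA bA eA]] : exists A : Vt -> Vt, [/\ linear A, bijective A &
    forall h z, Gm cl h -> A (tau (outer_pow cl e h) z) = tau h (A z)].
  apply: (simple_sub_isotypic twist_simple tau_simple
    (rhoV := fun h => sigma (inj0 h)) _ _ l0 _ (J := Phi \o t x)) => //.
  - by move=> h hG; apply/sigma_lin/inj0_M.
  - move=> x' h u hG; rewrite sigma_tensor/=; last exact: inj0_M.
    congr (t _ _); apply: functional_extensionality_dep => i.
    by rewrite sigmas1.
  - by apply: lin_comp; [move=> a u v; rewrite linearP|exact: l0].
  - move=> h z hG /=; rewrite -ePhi; last exact: inj0_M.
    rewrite twist_tensor//; last exact: inj0_M.
    congr (Phi (t _ _)); apply: functional_extensionality_dep => i.
    by rewrite sigmas_dual1// nsw.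
  - exists y => /= e0; apply: txy; apply: (bij_inj bPhi).
    by rewrite linear0 -e0.
by exists A; split.
Qed.

End ScalarCharacter.

Definition stabilizer : set (sperm r) :=
  [set w : sperm r | (forall i, ns (w.1 i) = ns i) /\ rep_iso (twist sigma w) sigma].

(** [T_w] sends the factor [j = w^-1 k] to the factor [k] by the coherent
    isomorphism with the sign of [w] at [j]. *)
Theorem stabilizer_operators : exists T : sperm r -> {linear V -> V},
  (forall w, stabilizer w -> bijective (T w) /\
     forall g v, lmem M g -> T w (twist sigma w g v) = sigma g (T w v)) /\
  (forall w1 w2, stabilizer w1 -> stabilizer w2 ->
     forall v, T (smul w1 w2) v = T w1 (T w2 v)).
Proof.
have [chi [chi0 chiE]] := scalar_character.
have [A [AP AM]] := sigmas_coherent chi0 chiE.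
have [B [BP BM]] := tau_coherent.
pose factor_iso (w : sperm r) := [/\ forall i, ns (w.1 i) = ns i,
  forall k, let j := (w.1^-1)%g k in exists D, @sigmas_iso chi j k (w.2 j) D &
  exists D, tau_iso (weyl_outer isB ns w) D].
have stab_iso w : stabilizer w -> factor_iso w.
  move=> [nsw riso]; split=> //; last exact: (tau_iso_exists chi0 chiE nsw riso).
  move=> k; have := sigmas_iso_exists chi0 chiE ((w.1^-1)%g k) nsw riso.
  by rewrite permKV.
have iso_mul w1 w2 : factor_iso w1 -> factor_iso w2 -> factor_iso (smul w1 w2).
  move=> [ns1 D1 E1] [ns2 D2 E2]; split=> [i|k|].
  - by rewrite /= permM ns1 ns2.
  - have [A1 iso1] := D1 k; have [A2 iso2] := D2 ((w1.1^-1)%g k).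
    rewrite /= invMg permM ffunE permKV.
    exists (A1 \o A2); exact: (sigmas_iso_comp chi0 chiE iso2 iso1).
  - have [A1 iso1] := E1; have [A2 iso2] := E2.
    rewrite weyl_outer_mul// addbC; exists (A1 \o A2); exact: tau_iso_comp iso2 iso1.
pose opT (w : sperm r) (T : V -> V) := forall x y, T (t x y) =
  t (fun k => let j := (w.1^-1)%g k in A j k (w.2 j) (x j)) (B (weyl_outer isB ns w) y).
have /choice[T TP] w : exists T : {linear V -> V}, factor_iso w -> opT w T.
  have [[nsw isoS isoT]|nw] := pselect (factor_iso w); last by exists idfun => /nw.
  have [|||| T [lT TE]] := @tensor_map _ _ _ _ _ t t_tensor (w.1^-1)%g w.1
    (fun k => A ((w.1^-1)%g k) k (w.2 ((w.1^-1)%g k))) (B (weyl_outer isB ns w)).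
  - exact: permKV.
  - exact: permK.
  - by move=> k; have [_ lA _ _] := AP _ _ _ (isoS k).
  - by have [lB _ _] := BP _ isoT.
  - by exists (linear_pack lT) => _ x y; exact: TE.
exists T; split=> [w wS|w1 w2 w1S w2S].
  have [nsw [Phi [bPhi ePhi]]] := wS.
  have wI := stab_iso _ wS; have [_ isoS isoT] := wI; have TPw := TP _ wI.
  have ePhi' g v : lmem M g -> Phi (twist sigma w g v) = sigma g (Phi v) by exact: ePhi.
  have twist_lin g : lmem M g -> linear (twist sigma w g).
    move=> gM a u v; apply: (bij_inj bPhi).
    by rewrite linearP !ePhi' // linearP sigma_lin.
  have eT g v : lmem M g -> T w (twist sigma w g v) = sigma g (T w v).
    move=> gM; move: v; apply: (tensor_ext t_tensor).
    - by move=> a u v; rewrite twist_lin// linearP.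
    - by move=> a u v; rewrite linearP sigma_lin.
    move=> x y; rewrite (twist_tensor chi0 chiE)// !TPw sigma_tensor//.
    have [_ _ eB] := BP _ isoT.
    congr (t _ _); last by rewrite eB//; case: gM.
    apply: functional_extensionality_dep => k /=.
    have [_ _ _ eA] := AP _ _ _ (isoS k).
    rewrite permKV eA//; case: gM => g1 _; exact: g1.
  split=> //.
  (* [T_w] is a nonzero multiple of the given isomorphism [Phi]. *)
  have [Psi PhiK PsiK] := bPhi.
  have lPsi : linear Psi by apply: (lin_can _ PhiK PsiK) => a u v; rewrite linearP.
  have [||c cP] := @sigma_schur (T w \o Psi).
  - by apply: lin_comp => // a u v; rewrite linearP.
  - move=> g v gM /=; rewrite -eT//; congr (T w _); apply: (bij_inj bPhi).
    by rewrite ePhi' // !PsiK.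
  have Tc v : T w v = c *: Phi v by rewrite -cP /= PhiK.
  have c0 : c != 0.
    apply/eqP => c0.
    have [x [y [_ x0 y0]]] := tensor_nonzero_factors t_tensor V_neq0.
    have [_ bB _] := BP _ isoT.
    have := Tc (t x y); rewrite c0 scale0r TPw.
    apply: (tensor_neq0 t_tensor); last first.
      by move=> By; apply: y0; apply: (bij_inj bB); rewrite By lin0//; have [] := BP _ isoT.
    move=> k /= Ax; have [_ lA bA _] := AP _ _ _ (isoS k).
    by apply: (x0 ((w.1^-1)%g k)); apply: (bij_inj bA); rewrite Ax (lin0 lA).
  by apply: eq_bij (scale_bijective c0 bPhi) _ _ => v; rewrite Tc.
have [I1 I2] := (stab_iso _ w1S, stab_iso _ w2S); have I12 := iso_mul _ _ I1 I2.
have [[ns1 S1 T1] [ns2 S2 T2]] := (I1, I2).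
(* The product [smul w1 w2] is [w1] after [w2], so its inverse at [k] is
   [w2^-1 (w1^-1 k)], and signs add up. *)
apply: (tensor_ext t_tensor) => [a u v|a u v|x y].
- by rewrite linearP.
- by rewrite !linearP.
rewrite !TP//=; congr (t _ _); last first.
  by rewrite BM// weyl_outer_mul// addbC.
apply: functional_extensionality_dep => k.
rewrite AM; [|exact: S2|exact: S1].
by rewrite invMg permM ffunE permKV.
Qed.

End IntertwiningOperators.

Theorem lemma3p1 (R : realType)
  (F : fieldType) (ord : F -> int) (q : nat)
  (F_local : nonarch_local_field ord q) (F_char0 : [pchar F] =i pred0)
  (isB : bool) (r : nat) (ns : 'I_r -> nat) (m : nat)
  (ns_gt0 : forall i, (0 < ns i)%N) (typeD_m : ~~ isB -> m != 1%N)
  (Cl : falgType F) (cl : {linear qspace F isB ns m -> Cl})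
  (cl_clifford : is_clifford cl)
  (M_proper : levi ord cl `<` Gn cl)
  (Vs : 'I_r -> lmodType R[i]) (Vt V : lmodType R[i])
  (sigmas : forall i, GL_group ord (ns i) -> Vs i -> Vs i)
  (tau : Gm_group ord cl -> Vt -> Vt)
  (sigma : levi_group ord cl -> V -> V)
  (sigmas_rep : forall i, is_rep (sigmas i)) (tau_rep : is_rep tau)
  (t : (forall i, Vs i) -> Vt -> V) (t_tensor : is_tensor t)
  (sigma_tensor : forall g, lmem (levi_group ord cl) g -> forall x y,
     sigma g (t x y) = t (fun i => sigmas i (g.1 i) (x i)) (tau g.2 y))
  (sigma_ds : irreducible_discrete_series sigma) :
  exists T : sperm r -> {linear V -> V},
    (forall w, R_group q sigma w ->
       bijective (T w) /\
       forall g v, lmem (levi_group ord cl) g ->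
         T w (twist sigma w g v) = sigma g (T w v)) /\
    (forall w1 w2, R_group q sigma w1 -> R_group q sigma w2 ->
       forall v, T (smul w1 w2) v = T w1 (T w2 v)).
Proof.
have [T [T_iso T_mul]] := stabilizer_operators F_local cl_clifford sigmas_rep
  tau_rep t_tensor sigma_tensor sigma_ds.
have stab w : R_group q sigma w -> stabilizer sigma w by move=> [[[nsw _] riso] _].
exists T; split=> [w /stab/T_iso//|w1 w2 /stab w1S /stab w2S]; exact: T_mul.
Qed.
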